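(* Let $(E,C)$ be a separated graph and let $\Omega(E,C)$ be the tight spectrum of the semilattice of idempotents of the inverse semigroup $\mathcal S(E,C)$. Then $\Omega(E,C)$ is $\mathbb F$-equivariantly homeomorphic to the tight spectrum of (the semilattice of idempotents of) $\mathcal{LI}(E,C)$, where $\mathbb F=\mathbb F(E^1)$ is the free group on $E^1$; that is, there are equivariant homeomorphisms $$\Omega(E,C)=\widehat{\mathcal E}_{\mathrm{tight}}(\mathcal S(E,C))\cong\widehat{\mathcal E}_{\mathrm{tight}}(\mathcal{LI}(E,C)).$$ Moreover, $\Omega(E,C)$ can be identified with the space $\mathfrak T_L$ of all those $Z\in\mathfrak F_L$ such that $Z$ does not have finite exits, endowed with the topology having as a basis of compact open sets all the sets $\mathcal Z_L(T\setminus F)\cap\mathfrak T_L$, where $T$ ranges over $\mathcal X_L$ and $F$ ranges over all finite subsets of $\mathcal N_L^{\mathrm{inf}}(T)$.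
   Context: Graphs and paths. A directed graph $E=(E^0,E^1,s,r)$ has arbitrary sets of vertices and edges and source/range maps $s,r$. A separated graph $(E,C)$ is a directed graph with $C=\bigsqcup_{v\in E^0}C_v$, where $C_v$ is a partition of $s^{-1}(v)$ into pairwise disjoint nonempty subsets ($C_v=\emptyset$ if $s^{-1}(v)=\emptyset$). For $e\in E^1$ let $e^{-1}$ be a formal inverse with $s(e^{-1})=r(e)$, $r(e^{-1})=s(e)$; $E^{-1}=\{e^{-1}\}$, $\hat E^1=E^1\cup E^{-1}$. A path is a vertex or a sequence $y_1\cdots y_n$ in $\hat E^1$ with $r(y_i)=s(y_{i+1})$; it is reduced if it has no subpath $xx^{-1}$, $x\in\hat E^1$. $\alpha\cdot\beta$ is the reduction of the concatenation $\alpha\beta$ when $r(\alpha)=s(\beta)$. $A^\downarrow$ is the set of prefixes of elements of $A$ (the vertex $s(\nu)$ is a prefix of $\nu$); lower subsets are those closed under prefixes; $[g]_1$ is the first letter of a nontrivial reduced path $g$. A $C$-separated path is a reduced path with no subpath $x^{-1}y$ with $x,y\in X$, $X\in C$. $\mathbb F_C(v)$ is the set of $C$-separated paths with source $v$; $\mathbb F_C=\bigsqcup_v\mathbb F_C(v)$. $\gamma,\nu\in\mathbb F_C(v)$ are $C$-compatible if $\nu^{-1}\cdot\gamma\in\mathbb F_C$; a set is $C$-compatible if its elements are pairwise so. Each reduced path is uniquely $g=g_Lw$, where $g_L$ is $s(g)$ or a prefix of $g$ ending in an edge $e\in X\in C$ with $|X|>1$, and $w$ is a (possibly empty) product of elements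 of $E^{-1}$ and edges $x$ with $\{x\}\in C$. Inverse semigroups. $\mathcal S(E,C)$ is the universal inverse semigroup (with zero) generated by $E^0\cup E^1\cup E^{-1}$ subject to: (1) $vw=\delta_{v,w}v$ for $v,w\in E^0$; (2) $s(x)x=x$, (3) $xr(x)=x$ for $x\in\hat E^1$; (4) $e^{-1}f=\delta_{e,f}r(e)$ for $e,f\in X$, $X\in C$. $\mathcal{LI}(E,C)$ has the same presentation with the additional relations (5) $ee^{-1}=s(e)$ for all $e$ with $\{e\}\in C$. For an inverse semigroup $S$ with zero, $\mathcal E(S)$ is its semilattice of idempotents; its spectrum is the set of nonzero semilattice homomorphisms $\phi\colon\mathcal E(S)\to\{0,1\}$ with $\phi(0)=0$ and the topology of pointwise convergence; the tight spectrum $\widehat{\mathcal E}_{\mathrm{tight}}(S)$ is the closure of the set of those $\phi$ for which $\phi^{-1}(1)$ is an ultrafilter. For $S=\mathcal S(E,C)$ or $\mathcal{LI}(E,C)$ there is an idempotent pure partial homomorphism $\pi\colon S\setminus\{0\}\to\mathbb F$ with $\pi(v)=1$, $\pi(e)=e$, and $\mathbb F$ acts partially on the (tight) spectrum: $\theta_g(\phi)(a)=\phi(s^{-1}as)$ for $\phi$ with $\phi(s^{-1}s)=1$, where $s\in\pi^{-1}(g)$. Leavitt model. $\mathfrak F_L(v)$ is the set of all (possibly infinite) nonempty $C$-compatible lower subsets $Z$ of $\mathbb F_C(v)$ such that each $z\in Z$ extends (possibly trivially) to an element of $Z$ that does not end in $E^{-1}$ and does not end in an edge $e$ with $\{e\}\in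 C$; $\mathfrak F_L=\bigsqcup_v\mathfrak F_L(v)$; $\mathcal X_L$ is the set of finite members of $\mathfrak F_L$. $\mathcal N_L^{\mathrm{inf}}(v)$ (resp. $\mathcal N_L^{\mathrm{fin}}(v)$) is the set of $\gamma y\in\mathbb F_C(v)$ with $\gamma$ a (possibly empty) product of inverse edges and edges $e$ with $\{e\}\in C$, and $y\in X\in C$ with $|X|=\infty$ (resp. $1<|X|<\infty$). For $Z\in\mathfrak F_L$ and $\bullet\in\{\mathrm{inf},\mathrm{fin}\}$, $\mathcal N_L^\bullet(Z)=\{gg'\in\mathbb F_C: g\in Z,\ g'\in\mathcal N_L^\bullet(r(g)),\ g[g']_1\notin Z,\ Z\cup\{gg'\}^\downarrow\in\mathfrak F_L\}$. Elements of $\mathcal N_L^{\mathrm{fin}}(Z)$ are the finite exits of $Z$; $Z$ does not have finite exits if $\mathcal N_L^{\mathrm{fin}}(Z)=\emptyset$. For $T\in\mathcal X_L$ and finite $F$, $\mathcal Z_L(T\setminus F)=\{Z\in\mathfrak F_L:T\subseteq Z,\ F\cap Z=\emptyset\}$. The identification of $\widehat{\mathcal E}_{\mathrm{tight}}(\mathcal{LI}(E,C))$ with $\mathfrak T_L$ sends $\phi$, with filter $\eta=\phi^{-1}(1)$, to the lower subset generated by $\{g_L: g\in\mathbb F_C,\ gg^{-1}\in\eta\}$. *)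

(* Defs.v *)
From HB Require Import structures.
From mathcomp Require Import all_boot generic_quotient.
From mathcomp Require Import all_classical topology.

Set Implicit Arguments.
Unset Strict Implicit.
Unset Printing Implicit Defensive.

Local Open Scope quotient_scope.
Local Open Scope classical_set_scope.
Local Open Scope group_scope.

(* The letter (a, true) stands for a and (a, false) for its formal inverse. *)
Section Words.
Context {A : choiceType}.
Implicit Types (x y : A * bool) (u v w : seq (A * bool)).

Definition linv x : A * bool := (x.1, ~~ x.2).

Definition reduced w : bool := sorted (fun x y => y != linv x) w.

Definition cons_red x w : seq (A * bool) :=
  if w is y :: w' then if y == linv x then w' else x :: w else [:: x].

Definition red w : seq (A * bool) := foldr cons_red [::] w.

Definition winv w : seq (A * bool) := rev (map linv w).

Lemma linvK : involutive linv.
Proof. by case=> a b; rewrite /linv /= negbK. Qed.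

Lemma winvK : involutive winv.
Proof. by move=> w; rewrite /winv map_rev revK mapK //; exact: linvK. Qed.

Lemma reduced_behead x w : reduced (x :: w) -> reduced w.
Proof. exact: path_sorted. Qed.

Lemma cons_red_reduced x w : reduced w -> reduced (cons_red x w).
Proof.
case: w => //= y w; case: eqP => [_ /path_sorted //|/eqP ne /=].
by rewrite ne.
Qed.

Lemma foldr_reduced w u : reduced w -> reduced (foldr cons_red w u).
Proof. by move=> rw; elim: u => //= x u; exact: cons_red_reduced. Qed.

Lemma red_reduced w : reduced (red w).
Proof. exact: foldr_reduced. Qed.

Lemma red_id w : reduced w -> red w = w.
Proof.
elim: w => //= x w IH rw; rewrite IH ?(reduced_behead rw) //.
by case: w rw {IH} => //= y w /andP[/negPf ->].
Qed.

Lemma cons_redK x w : reduced w -> cons_red x (cons_red (linv x) w) = w.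
Proof.
case: w => [_|y w rw] /=; first by rewrite eqxx.
rewrite linvK; case: (y =P x) => [yx|_] /=; last by rewrite eqxx.
subst y; case: w rw => [//|z w] /= /andP[/negPf -> _] //.
Qed.

Lemma foldr_red w u :
  reduced w -> foldr cons_red w (red u) = foldr cons_red w u.
Proof.
move=> rw; elim: u => //= x u <-; move: (red_reduced u).
case: (red u) => //= y v rv; case: eqP => [->|//].
by rewrite cons_redK // foldr_reduced.
Qed.

Lemma red_catl u v : red (red u ++ v) = red (u ++ v).
Proof. by rewrite /red !foldr_cat foldr_red // foldr_reduced. Qed.

Lemma red_catr u v : red (u ++ red v) = red (u ++ v).
Proof. by rewrite {1 3}/red !foldr_cat -/(red _) red_id ?red_reduced. Qed.

Lemma red_winv w : red (winv w ++ w) = [::].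
Proof.
elim: w => // x w IH; rewrite /winv map_cons rev_cons cat_rcons -IH /winv.
rewrite {1 2}/red !foldr_cat /=.
by rewrite -{2}[x]linvK cons_redK // foldr_reduced.
Qed.

Lemma winv_reduced w : reduced w -> reduced (winv w).
Proof.
rewrite /reduced /winv rev_sorted sorted_map; apply: sub_sorted => x y /=.
by apply: contra => /eqP e; rewrite e linvK.
Qed.

End Words.

Record freegroup (A : choiceType) :=
  FreeGroup { fgword :> seq (A * bool); _ : reduced fgword }.

HB.instance Definition _ (A : choiceType) := [isSub for @fgword A].
HB.instance Definition _ (A : choiceType) := [Choice of freegroup A by <:].

Section FreeGroup.
Context {A : choiceType}.
Implicit Types f g : freegroup A.

Lemma fgwordP g : reduced g. Proof. by case: g. Qed.

Definition fg_of (w : seq (A * bool)) : freegroup A := FreeGroup (red_reduced w).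
Definition fg_one : freegroup A := fg_of [::].
Definition fg_mul f g : freegroup A := fg_of (f ++ g).
Definition fg_inv f : freegroup A := FreeGroup (winv_reduced (fgwordP f)).

Lemma fg_mulA : associative fg_mul.
Proof. by move=> f g h; apply: val_inj; rewrite /= red_catl red_catr catA. Qed.

Lemma fg_mul1 : left_id fg_one fg_mul.
Proof. by move=> f; apply: val_inj; rewrite /= red_id ?fgwordP. Qed.

Lemma fg_mulr1 : right_id fg_one fg_mul.
Proof. by move=> f; apply: val_inj; rewrite /= cats0 red_id ?fgwordP. Qed.

Lemma fg_mulV : left_inverse fg_one fg_inv fg_mul.
Proof. by move=> f; apply: val_inj; rewrite /= red_winv. Qed.

Lemma fg_mulrV : right_inverse fg_one fg_inv fg_mul.
Proof.
move=> f; apply: val_inj => /=.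
by rewrite -{1}[fgword f]winvK red_winv.
Qed.

HB.instance Definition _ := isGroup.Build (freegroup A)
  fg_mulA fg_mul1 fg_mulr1 fg_mulV fg_mulrV.

End FreeGroup.

(* Equational axioms of inverse semigroups, plus an absorbing zero. *)
HB.mixin Record Semigroup_isInvSemigroup0 S & Semigroup S := {
  sinv : S -> S;
  szero : S;
  sinvK : involutive sinv;
  sinvM : forall x y : S, sinv (x * y) = sinv y * sinv x;
  smulKV : forall x : S, x * sinv x * x = x;
  sprojC : forall x y : S,
    (x * sinv x) * (y * sinv y) = (y * sinv y) * (x * sinv x);
  smul0l : forall x : S, szero * x = szero;
  smul0r : forall x : S, x * szero = szero
}.

#[short(type="invSemigroup0Type")]
HB.structure Definition InvSemigroup0 :=
  { S of Semigroup_isInvSemigroup0 S & Semigroup S }.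

Definition idem (S : invSemigroup0Type) := set_type [set a : S | a * a = a].

Section Idempotents.
Context {S : invSemigroup0Type}.
Implicit Types (x y s : S) (a b : idem S).

Lemma idemP a : val a * val a = val a.
Proof. exact: (set_valP a). Qed.

Definition mkidem x (h : x * x = x) : idem S :=
  SigSub (mem_set (h : [set a : S | a * a = a] x)).

Lemma idem_proj x : x * x = x -> x = x * sinv x.
Proof.
move=> xx; have xVV : sinv x * sinv x = sinv x by rewrite -sinvM xx.
have xVK : sinv x * x * sinv x = sinv x by have := smulKV (sinv x); rewrite sinvK.
suff -> : sinv x = x by rewrite xx.
have e1 : sinv x * x * (x * sinv x) = sinv x.
  by rewrite mulgA -[sinv x * x * x]mulgA xx xVK.
have e2 : x * sinv x * (sinv x * x) = x.
  by rewrite mulgA -[x * sinv x * sinv x]mulgA xVV smulKV.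
by rewrite -{1}e1 -{2}[x]sinvK sprojC sinvK e2.
Qed.

Lemma idemC x y : x * x = x -> y * y = y -> x * y = y * x.
Proof. by move=> /idem_proj -> /idem_proj ->; rewrite sprojC. Qed.

Lemma idem_mul_subproof a b : (val a * val b) * (val a * val b) = val a * val b.
Proof.
rewrite mulgA -[val a * val b * val a]mulgA (idemC (idemP b) (idemP a)).
by rewrite mulgA idemP -mulgA idemP.
Qed.

Lemma sran_subproof s : (s * sinv s) * (s * sinv s) = s * sinv s.
Proof. by rewrite mulgA smulKV. Qed.

Lemma sdom_subproof s : (sinv s * s) * (sinv s * s) = sinv s * s.
Proof. by rewrite -mulgA (mulgA s) smulKV. Qed.

Lemma sconj_subproof s a :
  (sinv s * val a * s) * (sinv s * val a * s) = sinv s * val a * s.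
Proof.
have C := idemC (sran_subproof s) (idemP a).
transitivity (sinv s * val a * ((s * sinv s) * val a) * s).
  by rewrite !mulgA.
rewrite C !mulgA -(mulgA (sinv s)) idemP -!mulgA; congr (_ * (_ * _)).
by rewrite mulgA smulKV.
Qed.

Definition idem_mul a b : idem S := mkidem (idem_mul_subproof a b).

Definition sran s : idem S := mkidem (sran_subproof s).

Definition sdom s : idem S := mkidem (sdom_subproof s).

Definition sconj s a : idem S := mkidem (sconj_subproof s a).

Definition idem0 : idem S := mkidem (smul0l szero).

End Idempotents.

Section Spectrum.
Variable S : invSemigroup0Type.

Definition idem_fun : topologicalType := {ptws idem S -> bool}.

Definition spectrum : set idem_fun :=
  [set phi : idem S -> bool | [/\ exists a, phi a, phi idem0 = false
    & forall a b, phi (idem_mul a b) = phi a && phi b]].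

(* Filters are proper; the order is a <= b iff a * b = a. *)
Definition idem_filter (eta : set (idem S)) : Prop :=
  [/\ eta !=set0, ~ eta idem0,
      forall a b, eta a -> eta b -> eta (idem_mul a b)
    & forall a b, eta a -> idem_mul a b = a -> eta b].

Definition idem_ultrafilter (eta : set (idem S)) : Prop :=
  idem_filter eta /\
  forall eta', idem_filter eta' -> eta `<=` eta' -> eta' = eta.

Definition ultra_spectrum : set idem_fun :=
  spectrum `&` [set phi : idem S -> bool | idem_ultrafilter [set a | phi a]].

(* The closure is taken inside the spectrum: the zero function is excluded. *)
Definition tight_set : set idem_fun := spectrum `&` closure ultra_spectrum.

Definition tight_spectrum : topologicalType := set_type tight_set.

End Spectrum.

Inductive iterm (G : Type) : Type :=
| IZero
| IGen of G
| IMul of iterm G & iterm G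
| IInv of iterm G.
Arguments IZero {G}.

HB.instance Definition _ (G : Type) := gen_eqMixin (iterm G).
HB.instance Definition _ (G : Type) := gen_choiceMixin (iterm G).

Section Presentation.
Variables (G : Type) (R : iterm G -> iterm G -> Prop).

Inductive pcong : iterm G -> iterm G -> Prop :=
| pcong_rel t u : R t u -> pcong t u
| pcong_refl t : pcong t t
| pcong_sym t u : pcong t u -> pcong u t
| pcong_trans t u w : pcong t u -> pcong u w -> pcong t w
| pcong_mul t t' u u' :
    pcong t t' -> pcong u u' -> pcong (IMul t u) (IMul t' u')
| pcong_inv t t' : pcong t t' -> pcong (IInv t) (IInv t')
| pcong_mulA t u w : pcong (IMul t (IMul u w)) (IMul (IMul t u) w)
| pcong_invK t : pcong (IInv (IInv t)) t
| pcong_invM t u : pcong (IInv (IMul t u)) (IMul (IInv u) (IInv t))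
| pcong_mulKV t : pcong (IMul (IMul t (IInv t)) t) t
| pcong_projC t u :
    pcong (IMul (IMul t (IInv t)) (IMul u (IInv u)))
          (IMul (IMul u (IInv u)) (IMul t (IInv t)))
| pcong_mul0l t : pcong (IMul IZero t) IZero
| pcong_mul0r t : pcong (IMul t IZero) IZero.

Lemma pcong_inv0 : pcong (IInv IZero) IZero.
Proof.
apply: pcong_trans (pcong_sym (pcong_mulKV (IInv IZero))) _.
apply: pcong_trans (pcong_mul0l (IInv IZero)).
apply: pcong_mul; last exact: pcong_refl.
apply: pcong_trans (pcong_mul0r (IInv IZero)).
by apply: pcong_mul; [exact: pcong_refl|exact: pcong_invK].
Qed.

Definition pcongb : rel (iterm G) := fun t u => `[< pcong t u >].

Lemma pcongb_equiv : equiv_class_of pcongb.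
Proof.
split.
- by move=> t; apply/asboolP; exact: pcong_refl.
- by move=> t u; apply/asboolP/asboolP; exact: pcong_sym.
- by move=> u t w /asboolP tu /asboolP uw; apply/asboolP; exact: pcong_trans uw.
Qed.

Canonical pcong_equiv : equiv_rel (iterm G) := EquivRelPack pcongb_equiv.

(* Terms modulo the least congruence containing R and the equational axioms of
   inverse semigroups with zero: this is the universal inverse semigroup with
   zero generated by G subject to R. *)
Definition presented : Type := {eq_quot pcong_equiv}.

HB.instance Definition _ := Choice.on presented.
HB.instance Definition _ := Quotient.on presented.

Implicit Types x y z : presented.

Lemma presentedP (t u : iterm G) :
  \pi_presented t = \pi_presented u <-> pcong t u.
Proof.
split=> [/eqquotP /asboolP //|tu].
by apply/eqquotP/asboolP.
Qed.

Lemma pcong_repr (t : iterm G) : pcong (repr (\pi_presented t)) t.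
Proof. by apply/presentedP; rewrite reprK. Qed.

Definition pmul x y : presented := \pi_presented (IMul (repr x) (repr y)).
Definition pinv x : presented := \pi_presented (IInv (repr x)).
Definition pzero : presented := \pi_presented IZero.

Lemma pmulE t u :
  pmul (\pi_presented t) (\pi_presented u) = \pi_presented (IMul t u).
Proof. by apply/presentedP; apply: pcong_mul; exact: pcong_repr. Qed.

Lemma pinvE t : pinv (\pi_presented t) = \pi_presented (IInv t).
Proof. by apply/presentedP; apply: pcong_inv; exact: pcong_repr. Qed.

Lemma presentedW (P : presented -> Prop) :
  (forall t, P (\pi_presented t)) -> forall x, P x.
Proof. by move=> Ppi x; rewrite -[x]reprK; exact: Ppi. Qed.

Lemma pmulA : associative pmul.
Proof.
elim/presentedW=> t; elim/presentedW=> u; elim/presentedW=> w.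
by rewrite !pmulE; apply/presentedP; exact: pcong_mulA.
Qed.

HB.instance Definition _ := isSemigroup.Build presented pmulA.

Lemma pinvK : involutive pinv.
Proof.
elim/presentedW=> t.
by rewrite !pinvE; apply/presentedP; exact: pcong_invK.
Qed.

Lemma pinvM x y : pinv (x * y) = pinv y * pinv x.
Proof.
elim/presentedW: x => t; elim/presentedW: y => u.
rewrite /mul /= !(pmulE, pinvE).
by apply/presentedP; exact: pcong_invM.
Qed.

Lemma pmulKV x : x * pinv x * x = x.
Proof.
elim/presentedW: x => t.
rewrite /mul /= !(pmulE, pinvE).
by apply/presentedP; exact: pcong_mulKV.
Qed.

Lemma pprojC x y : (x * pinv x) * (y * pinv y) = (y * pinv y) * (x * pinv x).
Proof.
elim/presentedW: x => t; elim/presentedW: y => u.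
rewrite /mul /= !(pmulE, pinvE).
by apply/presentedP; exact: pcong_projC.
Qed.

Lemma pmul0l x : pzero * x = pzero.
Proof.
elim/presentedW: x => t; rewrite /mul /= pmulE.
by apply/presentedP; exact: pcong_mul0l.
Qed.

Lemma pmul0r x : x * pzero = pzero.
Proof.
elim/presentedW: x => t; rewrite /mul /= pmulE.
by apply/presentedP; exact: pcong_mul0r.
Qed.

HB.instance Definition _ := Semigroup_isInvSemigroup0.Build presented
  pinvK pinvM pmulKV pprojC pmul0l pmul0r.

Definition pgen (g : G) : presented := \pi_presented (IGen g).

End Presentation.

(* [{classic T}] below is T with its classical choiceType structure. *)
Record sepgraph := SepGraph {
  vertex : Type;
  edge : Type;
  src : edge -> vertex;
  rng : edge -> vertex;
  sep : vertex -> set (set edge);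
  sep_partition : forall v, partition (sep v) id [set e | src e = v]
}.

Section SepGraph.
Variable E : sepgraph.
Implicit Types (v : vertex E) (e f : edge E) (X : set (edge E)).

Definition inC X : Prop := exists v, sep v X.

(* |X| > 1, including infinite X *)
Definition multi X : Prop := exists e f, [/\ X e, X f & e <> f].

Definition letter : choiceType := ({classic edge E} * bool)%type.

Definition free : groupType := freegroup {classic edge E}.

Definition pos e : letter := (e, true).
Definition neg e : letter := (e, false).

Definition lsrc (x : letter) : vertex E := if x.2 then src x.1 else rng x.1.
Definition lrng (x : letter) : vertex E := if x.2 then rng x.1 else src x.1.

Definition gens : Type := (vertex E + letter)%type.

Definition gv v : iterm gens := IGen (inl v).
Definition gx (x : letter) : iterm gens := IGen (inr x).

Inductive relS : iterm gens -> iterm gens -> Prop :=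
| relS_vv v : relS (IMul (gv v) (gv v)) (gv v)
| relS_vw v w : v <> w -> relS (IMul (gv v) (gv w)) IZero
| relS_src x : relS (IMul (gv (lsrc x)) (gx x)) (gx x)
| relS_rng x : relS (IMul (gx x) (gv (lrng x))) (gx x)
| relS_ee X e : inC X -> X e ->
    relS (IMul (gx (neg e)) (gx (pos e))) (gv (rng e))
| relS_ef X e f : inC X -> X e -> X f -> e <> f ->
    relS (IMul (gx (neg e)) (gx (pos f))) IZero.

Inductive relLI : iterm gens -> iterm gens -> Prop :=
| relLI_S t u : relS t u -> relLI t u
| relLI_ran e : inC [set e] ->
    relLI (IMul (gx (pos e)) (gx (neg e))) (gv (src e)).

Definition sgS : invSemigroup0Type := presented relS.
Definition sgLI : invSemigroup0Type := presented relLI.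

Definition Omega : topologicalType := tight_spectrum sgS.
Definition tightLI : topologicalType := tight_spectrum sgLI.

Fixpoint deg_term (t : iterm gens) : free :=
  match t with
  | IZero => 1
  | IGen (inl _) => 1
  | IGen (inr x) => fg_of [:: x]
  | IMul t u => deg_term t * deg_term u
  | IInv t => (deg_term t)^-1
  end.

Section PartialAction.
Variable R : iterm gens -> iterm gens -> Prop.

(* The partial homomorphism \pi; only meaningful away from zero, where it does
   not depend on the representative for R = relS, relLI (see [degE] below). *)
Definition deg (s : presented R) : free := deg_term (repr s).

Definition theta_dom (g : free) (phi : idem (presented R) -> bool) : Prop :=
  exists s : presented R, [/\ s <> szero, deg s = g & phi (sdom s)].

(* [theta g phi psi] means that phi is in the domain of \theta_g and
   \theta_g(phi) = psi. *)
Definition theta (g : free) (phi psi : idem (presented R) -> bool) : Prop :=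
  exists s : presented R, [/\ s <> szero, deg s = g, phi (sdom s)
    & forall a, psi a = phi (sconj s a)].

Definition graded : Prop :=
  forall t u, R t u -> pcong R t IZero \/ deg_term t = deg_term u.

Lemma degE (t : iterm gens) : graded ->
  \pi_(presented R) t <> szero -> deg (\pi_(presented R) t) = deg_term t.
Proof.
move=> gR t0; rewrite /deg; suff [t0'|->//] : pcong R t IZero \/
    deg_term (repr (\pi_(presented R) t)) = deg_term t.
  by case: t0; apply/presentedP.
have: pcong R t (repr (\pi_(presented R) t)).
  by apply: pcong_sym; exact: pcong_repr.
move: (repr _) => u {t0}; elim=> {t u}.
- by move=> t u /gR [|->]; [left|right].
- by right.
- move=> t u tu [t0|->]; [left|by right].
  exact: pcong_trans (pcong_sym tu) t0.
- move=> t u w tu [t0|etu] uw; first by left.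
  by move=> [u0|euw]; [left; exact: pcong_trans tu u0|right; rewrite euw].
- move=> t t' u u' _ [t0|et] _.
    move=> _; left; apply: pcong_trans (pcong_mul0l R u).
    by apply: pcong_mul => //; exact: pcong_refl.
  move=> [u0|eu]; [left|by right; rewrite /= eu et].
  apply: pcong_trans (pcong_mul0r R t).
  by apply: pcong_mul => //; exact: pcong_refl.
- move=> t t' _ [t0|et]; [left|by right; rewrite /= et].
  apply: pcong_trans (pcong_inv t0) _; exact: pcong_inv0.
- by right; rewrite /= mulgA.
- by right; rewrite /= invgK.
- by right; rewrite /= invgM.
- by right; rewrite /= mulgV mul1g.
- by right; rewrite /= !mulgV.
- by move=> t; left; exact: pcong_mul0l.
- by move=> t; left; exact: pcong_mul0r.
Qed.

Lemma degM (s t : presented R) : graded ->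
  s * t <> szero -> deg (s * t) = deg s * deg t.
Proof.
move=> gR; have -> : s * t = \pi_(presented R) (IMul (repr s) (repr t)) by [].
by move=> st0; rewrite degE.
Qed.

Lemma deg_vertex v : graded -> pgen R (inl v) <> szero ->
  deg (pgen R (inl v)) = 1.
Proof. by move=> gR v0; rewrite degE. Qed.

Lemma deg_letter (x : letter) : graded -> pgen R (inr x) <> szero ->
  deg (pgen R (inr x)) = fg_of [:: x].
Proof. by move=> gR x0; rewrite degE. Qed.

End PartialAction.

Lemma relS_graded : graded relS.
Proof.
move=> t u; case=> {t u}.
- by move=> v; right; rewrite /= mulg1.
- by move=> v w vw; left; apply: pcong_rel; exact: relS_vw.
- by move=> x; right; rewrite /= mul1g.
- by move=> x; right; rewrite /= mulg1.
- by move=> X e XC Xe; right; apply: val_inj; rewrite /= eqxx.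
- by move=> X e f XC Xe Xf ef; left; apply: pcong_rel; exact: relS_ef XC Xe Xf ef.
Qed.

Lemma pcong_relLI t u : pcong relS t u -> pcong relLI t u.
Proof.
elim=> *; try by constructor.
- by apply: pcong_rel; exact: relLI_S.
- by apply: pcong_trans; eauto.
Qed.

Lemma relLI_graded : graded relLI.
Proof.
move=> t u; case=> {t u}.
  by move=> t u /relS_graded [/pcong_relLI|]; [left|right].
by move=> e eC; right; apply: val_inj; rewrite /= eqxx.
Qed.

(* (v, [:: y_1; ...; y_n]) stands for the path y_1 ... y_n with source v, and
   (v, [::]) for the vertex v. *)
Definition gpath : Type := (vertex E * seq letter)%type.
Implicit Types (p q : gpath) (w : seq letter).

Fixpoint walk v w : Prop :=
  if w is x :: w' then lsrc x = v /\ walk (lrng x) w' else True.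

Definition prng p : vertex E := last p.1 (map lrng p.2).

Definition separated w : Prop :=
  forall X e f, inC X -> X e -> X f ->
    ~ (exists u u', w = u ++ [:: neg e, pos f & u']).

Definition FC v : set gpath :=
  [set p | [/\ p.1 = v, walk v p.2, reduced p.2 & separated p.2]].

Definition FCall : set gpath := [set p | FC p.1 p].

(* For p = \gamma and q = \nu: the reduced path \nu^{-1} . \gamma, whose source
   is r(\nu), lies in F_C. *)
Definition compatible p q : Prop :=
  FCall (prng q, red (winv q.2 ++ p.2)).

Definition pprefix p q : Prop := p.1 = q.1 /\ prefix p.2 q.2.

Definition down (A : set gpath) : set gpath :=
  [set p | exists2 q, A q & pprefix p q].

Definition lneutral (x : letter) : Prop := x.2 = false \/ inC [set (x.1 : edge E)].

Definition all_neutral w : Prop := forall x, x \in w -> lneutral x.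

Definition lbig (x : letter) : Prop :=
  x.2 /\ exists X, [/\ inC X, X x.1 & multi X].

(* [Lpart p q] means that q is the path p_L. *)
Definition Lpart p q : Prop :=
  exists w, [/\ p = (q.1, q.2 ++ w), all_neutral w
    & q.2 = [::] \/ exists u x, q.2 = rcons u x /\ lbig x].

Definition FL v : set (set gpath) :=
  [set Z | [/\ Z !=set0, Z `<=` FC v, down Z `<=` Z,
      forall p q, Z p -> Z q -> compatible p q
    & forall z, Z z -> exists z', [/\ Z z', pprefix z z'
        & forall u x, z'.2 = rcons u x -> ~ lneutral x]]].

Definition FLall : set (set gpath) := [set Z | exists v, FL v Z].

Definition XL : set (set gpath) := FLall `&` [set T | finite_set T].

(* The sets N_L^inf(v), N_L^fin(v), N_L^inf(Z) and N_L^fin(Z) are obtained by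
   taking for K the condition on |X|. *)
Section Exits.
Variable K : set (edge E) -> Prop.

Definition NLv v : set gpath :=
  [set p | FC v p /\ exists u y X,
    [/\ p.2 = rcons u (pos y), all_neutral u, inC X, X y & K X]].

Definition NL (Z : set gpath) : set gpath :=
  [set p | FCall p /\ exists g x w,
    [/\ Z g, NLv (prng g) (prng g, x :: w), p = (g.1, g.2 ++ x :: w),
        ~ Z (g.1, rcons g.2 x) & FLall (Z `|` down [set p])]].

End Exits.

Definition NLinf : set gpath -> set gpath := NL (fun X => infinite_set X).

Definition NLfin : set gpath -> set gpath :=
  NL (fun X => multi X /\ finite_set X).

Definition ZL (T F : set gpath) : set (set gpath) :=
  FLall `&` [set Z | T `<=` Z /\ F `&` Z = set0].

Definition TL_set : set (set gpath) := FLall `&` [set Z | NLfin Z = set0].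

Definition TL : Type := set_type TL_set.

HB.instance Definition _ := gen_eqMixin TL.
HB.instance Definition _ := gen_choiceMixin TL.

Definition TL_base : set (set TL) :=
  [set U | exists T F, [/\ XL T, finite_set F, F `<=` NLinf T
    & U = [set Z : TL | ZL T F (set_val Z)]]].

(* TL carries the coarsest topology in which the members of TL_base are open. *)
HB.instance Definition _ := isSubBaseTopological.Build TL TL_base id.

Definition path_elt p : sgLI :=
  foldl (fun s x => s * pgen relLI (inr x)) (pgen relLI (inl p.1)) p.2.

Definition L_model (phi : idem sgLI -> bool) : set gpath :=
  down [set q | exists2 g, FCall g /\ phi (sran (path_elt g)) & Lpart g q].

End SepGraph.

Arguments relS : clear implicits.
Arguments relLI : clear implicits.
Arguments TL_base : clear implicits.

Definition homeomorphism (X Y : topologicalType) (f : X -> Y) : Prop :=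
  continuous f /\
  exists g : Y -> X, [/\ cancel f g, cancel g f & continuous g].

Definition equivariant (E : sepgraph)
    {R R' : iterm (gens E) -> iterm (gens E) -> Prop}
    (h : tight_spectrum (presented R) -> tight_spectrum (presented R')) : Prop :=
  forall (g : free E) (phi : tight_spectrum (presented R)),
    (theta_dom g (set_val phi) <-> theta_dom g (set_val (h phi))) /\
    forall psi : tight_spectrum (presented R),
      theta g (set_val phi) (set_val psi)
      <-> theta g (set_val (h phi)) (set_val (h psi)).

(* Main.v *)
(* An idempotent of S(E,C) is zero or determined by finitely many reduced paths,
   and a character phi of the semilattice is determined by the set Z of the
   C-separated paths g with phi(g g^-1) = 1. Such a Z is a tree: closed under
   prefixes, with at most one edge of each X in C at every node. Ultrafilters
   correspond to the full trees, in which every inverse edge and some edge of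
   every X occur at each node. By Zorn's lemma a tree whose nodes have all inverse
   edges and an edge of every finite X (a complete tree) can be extended to a full
   one without meeting a given finite set of paths, so the tight characters are
   exactly those with Z complete. Conversely, a complete tree W yields a character
   through the partial action on complete trees in which a letter x sends W to
   x^-1 W. Since {e} in C is a finite set, this action also respects e e^-1 = s(e),
   and both semigroups have the same tight spectrum.
   The Leavitt model of a complete W is the lower subset generated by its paths
   that end in an edge of some X with |X| > 1; W is recovered by appending to the
   paths of the model all products of inverse edges and edges e with {e} in C. *)
Require Import Defs.
From mathcomp Require Import all_boot finmap.
From mathcomp Require Import all_classical topology.

Set Implicit Arguments.
Unset Strict Implicit.
Unset Printing Implicit Defensive.

Local Open Scope classical_set_scope.

(** * The topology of pointwise convergence *)

Lemma finite_bigcap_filter (T U : Type) (F : set_system T) (P : set U)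
    (f : U -> set T) : Filter F -> finite_set P -> (forall u, P u -> F (f u)) ->
  F (\bigcap_(u in P) f u).
Proof.
move=> FF /(@finite_fsetP {classic U})[X ->] H.
exact: (@filter_bigI _ {classic U}).
Qed.

Section Pointwise.
Variable U : Type.
Local Notation Y := {ptws U -> bool}.
Implicit Types (m : Y) (P : set U) (A : set Y).

Definition agree P m m' : Prop := forall u, P u -> m' u = m u.

(** Fixing finitely many coordinates gives a neighbourhood base because [bool] is discrete. One
    direction checks that the filter of these cylinders converges to [m] under every projection; the
    other writes a cylinder as a finite intersection of preimages of points. *)
Lemma ptws_nbhsP m (B : set Y) : nbhs m B <->
  exists2 P, finite_set P & agree P m `<=` B.
Proof.
split.
  pose F := filter_from (@finite_set U) (fun P => [set m' : Y | agree P m m']).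
  have FF : Filter F.
    apply: filter_from_filter; first by exists set0; exact: finite_set0.
    move=> P Q fP fQ; exists (P `|` Q); first by rewrite finite_setU.
    by move=> m' mm; split=> u Pu; apply: mm; [left|right].
  have : F --> m.
    apply/cvg_sup => u B' [V [[W oW <-] Wm] WB].
    exists [set u]; first exact: finite_set1.
    by move=> m' mm; apply: WB => /=; rewrite mm.
  by move=> /(_ B) H /H[P fP PB]; exists P.
move=> [P fP PB]; apply: filterS PB _.
have -> : agree P m = \bigcap_(u in P) [set m' : Y | m' u = m u].
  by apply/seteqP; split.
apply: finite_bigcap_filter => // u _.
have := @proj_continuous {classic U} (fun=> bool) u m [set m u].
by apply; rewrite nbhs_principalE; apply/principal_filterP.
Qed.

Lemma closure_agreeP A m : closure A m <->
  forall P, finite_set P -> exists2 m', A m' & agree P m m'.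
Proof.
split=> [cA P fP|H B /ptws_nbhsP[P /H[m' Am' mm] PB]].
  have [|m' [Am' mm]] := cA (agree P m); last by exists m'.
  by apply/ptws_nbhsP; exists P.
by exists m'; split=> //; exact: PB.
Qed.

Lemma open_agree A (B : set (set_type A)) :
  (forall x, B x -> exists2 P, finite_set P &
     forall y, agree P (set_val x) (set_val y) -> B y) -> open B.
Proof.
move=> H; rewrite openE => x /H[P fP PB].
have nP : nbhs (set_val x : Y) (agree P (set_val x)) by apply/ptws_nbhsP; exists P.
have : nbhs x (set_val @^-1` agree P (set_val x)).
  exact: (@initial_continuous (set_type A) Y set_val x).
by apply: filterS => y; exact: PB.
Qed.

Lemma continuous_agree (X : topologicalType) A (f : X -> set_type A) :
  (forall u, open [set x | set_val (f x) u] /\ open [set x | ~~ set_val (f x) u]) ->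
  continuous f.
Proof.
move=> H x B [_ [[O oO <-] Ox OB]].
have /ptws_nbhsP[P fP PO] : nbhs (set_val (f x) : Y) O.
  by apply: open_nbhs_nbhs; split.
apply: (@filterS _ _ _ (\bigcap_(u in P) [set y | set_val (f y) u = set_val (f
  x) u])).
  by move=> y yP; apply: OB; apply: PO => u /yP.
apply: finite_bigcap_filter => // u _; have [o1 o2] := H u.
have [xu|xu] := boolP (set_val (f x) u).
  exact: filterS (open_nbhs_nbhs (conj o1 xu)).
by apply: filterS (open_nbhs_nbhs (conj o2 xu)) => y /negPf.
Qed.

(** Tychonoff makes [C] compact in the full power, where [A] itself need not be closed. A cluster
    point of a filter pushed forward along the inclusion lies in [C], hence in [A]. *)
Lemma compact_agree A (C : set Y) : C `<=` A -> closed C ->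
  compact [set x : set_type A | C (set_val x)].
Proof.
move=> CA clC.
have cC : compact C.
  apply: (subclosed_compact clC (B := setT)) => //.
  have := @tychonoff {classic U} (fun=> bool) (fun=> setT) (fun=> bool_compact).
  by congr compact; apply/seteqP; split.
move=> F FF FC; have [|c [Cc clc]] := cC (set_val @ F) _.
  by apply: filterS FC.
have Ac : c \in A by apply/mem_set/CA.
exists (SigSub Ac : set_type A); split=> //= B N FB [_ [[O oO <-] Oc ON]].
have FB' : (set_val @ F) (set_val @` B).
  by rewrite /= /fmap /=; apply: filterS FB => y By; exists y.
have [_ [[y By <-] Oy]] := clc _ _ FB' (open_nbhs_nbhs (conj oO Oc)).
by exists y; split=> //; exact: ON.
Qed.

End Pointwise.

(** * Words *)

Section Words.
Context {A : choiceType}.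
Implicit Types (x y : A * bool) (u v w : seq (A * bool)).

Lemma reduced_catl u v : reduced (u ++ v) -> reduced u.
Proof. by move=> /cat_sorted2[]. Qed.

Lemma reduced_catr u v : reduced (u ++ v) -> reduced v.
Proof. by move=> /cat_sorted2[]. Qed.

Lemma reduced_rcons w x y :
  reduced (rcons (rcons w x) y) = (y != linv x) && reduced (rcons w x).
Proof.
rewrite /reduced; case: w => [|z w] /=; first by rewrite andbT.
by rewrite rcons_path last_rcons andbC.
Qed.

Lemma red_rconsK w x : reduced w -> red (rcons (rcons w x) (linv x)) = w.
Proof.
move=> rw; rewrite -!cats1 -catA -red_catr /=.
by rewrite /= eqxx cats0 red_id.
Qed.

(** [red] works from the left whereas paths grow on the right; the two cases are cancellation of the
    last letter and appending. *)
Variant red_rcons_spec w x : seq (A * bool) -> Prop :=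
| RedRconsK u of w = rcons u (linv x) : red_rcons_spec w x u
| RedRcons of reduced (rcons w x) : red_rcons_spec w x (rcons w x).

Lemma red_rconsP w x : reduced w -> red_rcons_spec w x (red (rcons w x)).
Proof.
case/lastP: w => [|w y] rw; first exact: RedRcons.
case: (eqVneq x (linv y)) => [->|nxy].
  rewrite red_rconsK; last by rewrite -cats1 in rw; exact: reduced_catl rw.
  by apply: RedRconsK; rewrite linvK.
have r : reduced (rcons (rcons w y) x) by rewrite reduced_rcons nxy.
by rewrite red_id //; exact: RedRcons.
Qed.

Lemma winv_cat u v : winv (u ++ v) = winv v ++ winv u.
Proof. by rewrite /winv map_cat rev_cat. Qed.

Lemma winv_rcons w x : winv (rcons w x) = linv x :: winv w.
Proof. by rewrite /winv map_rcons rev_rcons. Qed.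

(** Both sides are inverse to the class of [w] in the free group. *)
Lemma winv_red w : winv (red w) = red (winv w).
Proof.
suff: fg_inv (fg_of w) = fg_of (winv w) by move/(congr1 val).
have : fg_mul (fg_of (winv w)) (fg_of w) = fg_one.
  by apply: val_inj; rewrite /= red_catl red_catr red_winv.
move=> e; rewrite -[LHS]fg_mul1 -e -fg_mulA fg_mulrV.
by rewrite fg_mulr1.
Qed.

End Words.

(** * Trees of reduced paths *)

Section Trees.
Variable E : sepgraph.
Implicit Types (u v : vertex E) (e f : edge E) (X : set (edge E)).
Implicit Types (x y : letter E) (w : seq (letter E)) (p q : gpath E).
Implicit Types (Z W : set (gpath E)).

Lemma lsrc_linv x : lsrc (linv x) = lrng x.
Proof. by case: x => e []. Qed.

Lemma lrng_linv x : lrng (linv x) = lsrc x.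
Proof. by case: x => e []. Qed.

Lemma prng_rcons v w x : prng (v, rcons w x) = lrng x.
Proof. by rewrite /prng /= map_rcons last_rcons. Qed.

Lemma walk_cat v w1 w2 :
  walk v (w1 ++ w2) <-> walk v w1 /\ walk (prng (v, w1)) w2.
Proof.
elim: w1 v => [|x w1 IH] v /=; first by split=> [|[]].
by rewrite IH; split=> [[? []]|[[? ?] ?]].
Qed.

Lemma walk_rcons v w x :
  walk v (rcons w x) <-> walk v w /\ lsrc x = prng (v, w).
Proof. by rewrite -cats1 walk_cat /=; split=> [[? []]|[? ?]]. Qed.

Lemma walk_red v w :
  walk v w -> walk v (red w) /\ prng (v, red w) = prng (v, w).
Proof.
elim: w v => //= x w IH v [<- /IH]; rewrite /prng /=.
case: (red w) => [|y w'] /=; first by move=> [_ <-].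
case: eqP => [->|_] /=; last by move=> [].
by rewrite lsrc_linv lrng_linv => -[[_ ?] <-].
Qed.

Lemma walk_winv v w : walk v w ->
  walk (prng (v, w)) (winv w) /\ prng (prng (v, w), winv w) = v.
Proof.
elim/last_ind: w => [|w x IH] //; rewrite walk_rcons prng_rcons winv_rcons.
by move=> [/IH[ww pw] xE]; rewrite /= lsrc_linv /prng /= lrng_linv xE.
Qed.

(** * Neighbours and walks in trees; trees as compatible lower subsets *)

Definition act p w : gpath E := (p.1, red (p.2 ++ w)).

Lemma actA p w1 w2 : act (act p w1) w2 = act p (w1 ++ w2).
Proof. by rewrite /act /= red_catl catA. Qed.

Lemma act_reduced p w : reduced (act p w).2.
Proof. exact: red_reduced. Qed.

Lemma act_red p w : act p (red w) = act p w.
Proof. by rewrite /act red_catr. Qed.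

Lemma act_nil p : reduced p.2 -> act p [::] = p.
Proof. by case: p => v w rw; rewrite /act cats0 red_id. Qed.

Lemma act_linv p x : reduced p.2 -> act (act p [:: x]) [:: linv x] = p.
Proof. by move=> rp; rewrite actA -act_red /= eqxx act_nil. Qed.

Lemma act_rcons v w x : reduced (rcons w x) -> act (v, w) [:: x] = (v, rcons w x).
Proof. by move=> r; rewrite /act /= cats1 red_id. Qed.

(* [act p [:: x]] is the neighbour of [p] along [x], whether it is a child or the
   parent of [p]: the last condition also covers the edge through which a node
   was reached. *)
Definition tree v Z : Prop :=
  [/\ Z (v, [::]),
      forall p, Z p -> [/\ p.1 = v, walk v p.2 & reduced p.2],
      forall u w x, Z (u, rcons w x) -> Z (u, w)
    & forall p X e f, Z p -> inC X -> X e -> X f ->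
        Z (act p [:: pos e]) -> Z (act p [:: pos f]) -> e = f].

(** If [x] cancelled the last letter of [p], the neighbour would be the parent of [p], which a
    prefix-closed set contains. So a missing neighbour is always a child. *)
Lemma tree_act v Z p x : tree v Z -> Z p -> ~ Z (act p [:: x]) ->
  reduced (rcons p.2 x) /\ act p [:: x] = (p.1, rcons p.2 x).
Proof.
move=> tZ Zp; have [_ /(_ _ Zp)[_ _ rp] Zr _] := tZ; rewrite /act cats1.
case: red_rconsP => // w pE; case: p Zp rp pE => u w' /= Zp _ pE.
by case; apply: (Zr _ _ (linv x)); rewrite -pE.
Qed.

(** The word need not be reduced, so a walk may backtrack; the starting point [p] is not itself
    required to lie in [Z]. *)
Fixpoint walkable Z p w : Prop :=
  if w is x :: w' then Z (act p [:: x]) /\ walkable Z (act p [:: x]) w' else True.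

Lemma walkable_cat Z p w1 w2 : reduced p.2 ->
  walkable Z p (w1 ++ w2) <-> walkable Z p w1 /\ walkable Z (act p w1) w2.
Proof.
elim: w1 p => [|x w1 IH] p rp; first by rewrite act_nil //; split=> [|[]].
rewrite /= IH ?act_reduced // -/(cat [:: x] w1) actA.
by split=> [[? []]|[[? ?] ?]].
Qed.

Lemma walkable_end Z p w : reduced p.2 -> Z p -> walkable Z p w -> Z (act p w).
Proof.
elim: w p => [|x w IH] p rp Zp /=; first by rewrite act_nil.
by move=> [Zx /(IH _ (act_reduced _ _) Zx)]; rewrite actA.
Qed.

(** Cancelling a pair x x^-1 removes a detour from a node to a neighbour and back. *)
Lemma walkable_red Z p w : reduced p.2 -> walkable Z p w -> walkable Z p (red w).
Proof.
elim: w p => //= x w IH p rp [Zx /(IH _ (act_reduced _ _))].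
case: (red w) => [|y w'] //=; case: eqP => [->|_] //=.
by rewrite act_linv // => -[].
Qed.

(** In a subpath e^-1 f, the middle node has the previous node as its neighbour along e and the next
    one as its neighbour along f. If e and f are in one class, then e = f and the word is not
    reduced. *)
Lemma walkable_separated v Z p w : tree v Z -> reduced p.2 -> Z p ->
  walkable Z p w -> reduced w -> Defs.separated w.
Proof.
move=> [_ _ _ Zsep] rp Zp + rw X e f XC Xe Xf [w1 [w2 wE]].
have nef : e <> f.
  move=> ef; move: rw; rewrite wE ef => /reduced_catr.
  by rewrite /reduced /= /linv /= eqxx.
rewrite wE -cat1s catA walkable_cat // => -[+ [Zf _]].
rewrite walkable_cat // => -[Z1 /= [Ze _]].
have Zw1 := walkable_end rp Zp Z1.
apply: nef; apply: (Zsep (act p (w1 ++ [:: neg e])) X) => //.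
  by rewrite -actA.
rewrite -actA; have -> : pos e = linv (neg e) by [].
by rewrite act_linv // act_reduced.
Qed.

Lemma walkable_root v Z p : tree v Z -> Z p -> walkable Z (v, [::]) p.2.
Proof.
move=> tZ; have [_ ZF Zr _] := tZ; case: p => u w.
elim/last_ind: w => //= w x IH Zwx; have [/= uE _ rwx] := ZF _ Zwx.
have Zw := Zr _ _ _ Zwx; have [/= _ _ rw] := ZF _ Zw.
rewrite -cats1 walkable_cat //; split; first exact: IH.
by rewrite /= /act /= red_catl cats1 red_id // -uE.
Qed.

Lemma walkable_winv v Z p : tree v Z -> Z p -> walkable Z p (winv p.2).
Proof.
move=> tZ; have [_ ZF Zr _] := tZ; case: p => u w.
elim/last_ind: w => //= w x IH Zwx; have [/= uE _ rwx] := ZF _ Zwx.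
have Zw := Zr _ _ _ Zwx; have [/= _ _ rw] := ZF _ Zw.
rewrite winv_rcons /= /act /= cats1 red_rconsK //; split => //; exact: IH.
Qed.

Lemma act_winv p : act p (winv p.2) = (p.1, [::]).
Proof. by rewrite /act -{1}[p.2]winvK red_winv. Qed.

Lemma tree_FC v Z : tree v Z -> Z `<=` FC v.
Proof.
move=> tZ p Zp; have [Z0 ZF _ _] := tZ; have [pv wp rp] := ZF _ Zp.
by split => //; apply: walkable_separated tZ _ Z0 (walkable_root tZ Zp) rp.
Qed.

(** The word q^-1 p labels the walk in [Z] from [q] back to the root and on to [p]; its reduction is
    still a walk in [Z]. *)
Lemma tree_compatible v Z p q : tree v Z -> Z p -> Z q -> compatible p q.
Proof.
move=> tZ Zp Zq; have [Z0 ZF _ _] := tZ.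
have [pv wp rp] := ZF _ Zp; have [qv wq rq] := ZF _ Zq.
have [wq' qE] := walk_winv wq; rewrite /compatible /FCall /FC /= -/(prng q).
have qvE : q = (v, q.2) by case: q qv {Zq wq rq wq' qE} => ? ? /= ->.
rewrite -qvE in wq' qE.
split=> //; [|exact: red_reduced|].
  suff /walk_red[] : walk (prng q) (winv q.2 ++ p.2) by [].
  by rewrite walk_cat qE.
apply: (walkable_separated tZ rq Zq _ (red_reduced _)).
apply: walkable_red => //; rewrite walkable_cat // act_winv qv.
by split; [exact: walkable_winv tZ Zq|exact: walkable_root tZ Zp].
Qed.

Lemma compatible_tree v Z : Z !=set0 -> Z `<=` FC v -> Defs.down Z `<=` Z ->
  (forall p q, Z p -> Z q -> compatible p q) -> tree v Z.
Proof.
move=> [p0 Zp0] ZF Zd Zc; split.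
- by apply: Zd; exists p0 => //; split=> //=; [case: (ZF _ Zp0)|exact: prefix0s].
- by move=> p /ZF[].
- by move=> u w x Zx; apply: Zd; exists (u, rcons w x) => //; split => //;
  exact: prefix_rcons.
move=> p X e f Zp XC Xe Xf Ze Zf; apply: contrapT => nef.
(* For the neighbours p e and p f the word required to be separated is (p f)^-1 (p e) = f^-1 e. *)
have [_ _ _ /(_ X f e XC Xf Xe)] := Zc _ _ Ze Zf; apply; exists [::], [::].
rewrite winv_red red_catl red_catr winv_cat -catA.
rewrite -red_catr (catA (winv p.2)) -(red_catl (winv p.2 ++ p.2)) red_winv /=.
by rewrite /cons_red; case: eqP => // -[ef]; case: nef.
Qed.


(** * Classes of edges and prefix-closed sets *)

Lemma sep_src v X e : sep v X -> X e -> src e = v.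
Proof.
by have [cov _ _] := sep_partition v => sX Xe;
  rewrite -[_ = _]/([set e | _] e) -cov; exists X.
Qed.

Lemma sep_nonempty v X : sep v X -> X !=set0.
Proof. by have [_ _ ne] := sep_partition v; apply: ne. Qed.

Lemma sep_ex e : exists2 X, sep (src e) X & X e.
Proof.
have [cov _ _] := sep_partition (src e).
have : [set f | src f = src e] e by [].
by rewrite -cov => -[X]; exists X.
Qed.

Lemma inC_eq X1 X2 e : inC X1 -> inC X2 -> X1 e -> X2 e -> X1 = X2.
Proof.
move=> [v1 s1] [v2 s2] e1 e2.
have v12 : v1 = v2 by rewrite -(sep_src s1 e1) (sep_src s2 e2).
rewrite -v12 in s2; have [_ tI _] := sep_partition v1.
by apply: tI => //; exists e.
Qed.

Lemma inC_sep X e : inC X -> X e -> sep (src e) X.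
Proof. by move=> [v sX] Xe; rewrite (sep_src sX Xe). Qed.

Lemma act_inj p : injective (fun x => act p [:: x]).
Proof.
move=> x y [/(congr1 (fun w => red (winv p.2 ++ w)))].
by rewrite !red_catr !catA -!(red_catl (winv p.2 ++ p.2)) red_winv /= => -[].
Qed.

Lemma sep_inC v X : sep v X -> inC X.
Proof. by exists v. Qed.

Definition lowerset Z : Prop := forall u w x, Z (u, rcons w x) -> Z (u, w).

Lemma lowerset_cat Z u w1 w2 : lowerset Z -> Z (u, w1 ++ w2) -> Z (u, w1).
Proof.
move=> Zr; elim/last_ind: w2 => [|w2 x IH]; first by rewrite cats0.
by rewrite -rcons_cat => /Zr.
Qed.

Lemma lowerset_down Z : lowerset (Defs.down Z).
Proof.
move=> u w x [q Zq [qu pq]]; exists q => //; split => //=.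
exact: prefix_trans (prefix_rcons _ _) pq.
Qed.

Lemma downW Z : Z `<=` Defs.down Z.
Proof. by move=> p Zp; exists p => //; split=> //; exact: prefix_refl. Qed.

Lemma lowerset_sub Z Z' : lowerset Z -> Z' `<=` Z -> Defs.down Z' `<=` Z.
Proof.
move=> lZ ZZ [u w] [[u' w'] /ZZ Zq [/= -> /prefixP[w2 wE]]].
by apply: (@lowerset_cat _ _ _ w2) => //; rewrite -wE.
Qed.

Lemma tree_lowerset v Z : tree v Z -> lowerset Z.
Proof. by case. Qed.

Lemma tree_root v Z p : tree v Z -> Z p -> p.1 = v.
Proof. by case=> _ ZF _ _ /ZF[]. Qed.

Lemma tree_reduced v Z p : tree v Z -> Z p -> reduced p.2.
Proof. by case=> _ ZF _ _ /ZF[]. Qed.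

Lemma tree_walk v Z p : tree v Z -> Z p -> walk p.1 p.2.
Proof. by case=> _ ZF _ _ /ZF[->]. Qed.

(** * Subtrees, full extensions and translates of trees *)

Lemma tree_sub v Z Z' : tree v Z -> Z' `<=` Z -> Z' (v, [::]) ->
  lowerset Z' -> tree v Z'.
Proof.
move=> [Z0 ZF Zr Zs] ZZ Z'0 lZ'; split=> //; first by move=> p /ZZ /ZF.
by move=> p X e f /ZZ Zp XC Xe Xf /ZZ Ze /ZZ Zf; exact: Zs Zp XC Xe Xf Ze Zf.
Qed.

(** The new node is a leaf, adjacent only to [p]. So the edge condition could fail only at [p],
    where the last hypothesis prevents it. *)
Lemma tree_extend v Z p x : tree v Z -> Z p -> lsrc x = prng p ->
  ~ Z (act p [:: x]) ->
  (forall X f, x.2 -> inC X -> X x.1 -> X f -> ~ Z (act p [:: pos f])) ->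
  tree v (Z `|` [set act p [:: x]]).
Proof.
move=> tZ Zp xp nZ nX; have [rq qE] := tree_act tZ Zp nZ.
have [Z0 ZF Zr Zs] := tZ; have [pv wp rp] := ZF _ Zp.
rewrite qE in nZ *; set q := (_, _) in nZ *.
have qy r y : Z r -> act r [:: y] = q -> r = p /\ y = x.
  move=> Zr'; have [_ _ rr] := ZF _ Zr';
    move=> /(congr1 (fun s => act s [:: linv y])).
  rewrite act_linv // /q /act /= cats1; case: red_rconsP => //.
    move=> u; rewrite linvK => /rcons_inj[<- <-] ->.
    by case: (p).
  by move=> _ rE; case: nZ; apply: (Zr _ _ (linv y)); rewrite -rE.
have qyZ y : (Z `|` [set q]) (act q [:: y]) -> y = linv x.
  rewrite /act /= cats1; case: red_rconsP => // [u /rcons_inj[_ ->]|_].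
    by rewrite linvK.
  case=> [/Zr //|[]] /(congr1 size); rewrite !size_rcons => /eqP.
  by rewrite eqn_leq ltnn.
split.
- by left.
- move=> r [/ZF //|->]; split=> //=; apply/walk_rcons; split => //.
  by rewrite xp -pv; case: (p).
- by move=> u w y [/Zr|[-> /rcons_inj[-> _]]]; left => //; case: (p) Zp => ? ?.
move=> r X e f [Zr'|->] XC Xe Xf; last first.
  by move=> /qyZ ex /qyZ fx; have /(congr1 fst) : pos e = pos f by rewrite ex fx.
have nn g h : X g -> X h -> act r [:: pos g] = q -> ~ Z (act r [:: pos h]).
  by move=> Xg Xh /(qy _ _ Zr')[-> gx]; apply: (nX X); rewrite -?gx.
move=> [Ze|qe] [Zf|qf]; first exact: Zs Zr' XC Xe Xf Ze Zf.
- by case: (nn _ _ Xf Xe qf).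
- by case: (nn _ _ Xe Xf qe).
have [_ ex] := qy _ _ Zr' qe; have [_ fx] := qy _ _ Zr' qf.
by have /(congr1 fst) : pos e = pos f by rewrite ex fx.
Qed.

(* [K = finite_set] will describe the tight characters, [K = setT] the
   ultrafilters. *)
Definition complete_at (K : set (set (edge E))) Z p : Prop :=
  (forall e, rng e = prng p -> Z (act p [:: neg e])) /\
  (forall X, sep (prng p) X -> K X -> exists2 e, X e & Z (act p [:: pos e])).

Definition complete K Z : Prop := forall p, Z p -> complete_at K Z p.

(** [M] is a maximal tree over [Z] whose intersection with [P] lies in [Z]. Children of a node
    outside [P] are outside [P], so maximality applies to them. A node of [M] in [P] lies in [Z];
    there completeness of [Z] supplies the inverse edges and the finite classes, while an infinite
    class has an edge leading out of the finite set [P]. *)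
Lemma complete_extension v Z (P : set (gpath E)) :
  tree v Z -> lowerset P -> finite_set P ->
  (forall p, Z p -> P p -> complete_at finite_set Z p) ->
  exists M, [/\ tree v M, Z `<=` M, M `&` P `<=` Z & complete setT M].
Proof.
move=> tZ lP fP Zc.
(* The premise that [A] is nonempty makes [Q] hold for the union of the empty chain. *)
pose Q (A : set (gpath E)) := A !=set0 -> [/\ tree v A, Z `<=` A & A `&` P `<=` Z].
have [F FQ Ftot|M [QM Mmax]] := @Zorn_bigcup _ Q.
  have FP A p : F A -> A p -> [/\ tree v A, Z `<=` A & A `&` P `<=` Z].
    by move=> FA Ap; apply: (FQ _ FA); exists p.
  move=> [p0 [A0 FA0 A0p]]; have [[A00 _ _ _] ZA0 _] := FP _ _ FA0 A0p.
  split; last first.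
  - by move=> p [[A FA Ap] Pp]; have [_ _] := FP _ _ FA Ap; apply.
  - by move=> p /ZA0; exists A0.
  split; first by exists A0.
  - by move=> p [A FA Ap]; have [[_ + _ _] _ _] := FP _ _ FA Ap; apply.
  - move=> u w x [A FA Ap]; have [[_ _ /(_ _ _ _ Ap) Aw _] _ _] := FP _ _ FA Ap.
    by exists A.
  move=> p X e f [A FA Ap] XC Xe Xf [B FB Be] [C FC Cf].
  have [D FD [Dp De Df]] : exists2 D, F D
      & [/\ D p, D (act p [:: pos e]) & D (act p [:: pos f])].
    have [sAB|sBA] := Ftot _ _ FA FB.
      by have [sBC|sCB] := Ftot _ _ FB FC; [exists C|exists B] => //; split=> //;
         [exact/sBC/sAB|exact/sBC|exact/sAB|exact/sCB].
    by have [sAC|sCA] := Ftot _ _ FA FC; [exists C|exists A] => //; split=> //;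
       [exact/sAC|exact/sAC/sBA|exact/sBA|exact/sCA].
  by have [[_ _ _ Ds] _ _] := FP _ _ FD Dp; exact: Ds Dp XC Xe Xf De Df.
have [Z0 _ _ _] := tZ.
have [tM ZM MP] : [/\ tree v M, Z `<=` M & M `&` P `<=` Z].
  apply: QM; apply/set0P/eqP => M0; apply: (Mmax Z).
    by rewrite M0; split=> // /(_ _ Z0).
  by move=> _; split => //; exact: subIsetl.
have Mx p x : M p -> lsrc x = prng p -> ~ P (act p [:: x]) ->
    (forall X f, x.2 -> inC X -> X x.1 -> X f -> ~ M (act p [:: pos f])) ->
    M (act p [:: x]).
  move=> Mp xp nP nX; apply: contrapT => nM.
  apply: (Mmax (M `|` [set act p [:: x]])).
    by split; [move=> q Mq; left|move=> MxM; apply/nM/MxM; right].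
  move=> _; split; first exact: tree_extend.
    by move=> q /ZM; left.
  by move=> q [[Mq|->] Pq //]; apply: MP.
exists M; split=> // p Mp; split=> [e ep|X sX _].
  have [//|nM] := pselect (M (act p [:: neg e])).
  have [rq qE] := tree_act tM Mp nM.
  have [Pp|nPp] := pselect (P p).
    by have [/(_ _ ep) /ZM] := Zc _ (MP _ (conj Mp Pp)) Pp.
  by apply: Mx => // Pq; apply: nPp; case: (p) Pq qE => u w /= + qE;
    rewrite qE; exact: lP.
apply: contrapT => nX.
have nX' e : X e -> ~ M (act p [:: pos e]) by move=> Xe Me; apply: nX; exists e.
(* If [p] is in [P] and every edge of [X] leads into [P], then [X] is finite by injectivity of [act]
   on letters, and completeness of [Z] at [p] contradicts [nX]. *)
have [e Xe nPe] : exists2 e, X e & ~ P (act p [:: pos e]).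
  have [Pp|nPp] := pselect (P p); last first.
    have [e Xe] := sep_nonempty sX; exists e => // Pe; apply: nPp.
    have [_ qE] := tree_act tM Mp (nX' _ Xe).
    by rewrite qE in Pe; case: (p) Pe => u w /=; exact: lP.
  apply: contrapT => nPe.
  have fX : finite_set X.
    apply: (@sub_finite_set _ _ ((fun e => act p [:: pos e]) @^-1` P)).
      by move=> e Xe; apply: contrapT => Pe; apply: nPe; exists e.
    by apply: finite_preimage => // e f _ _ /act_inj[].
  have [_ /(_ X sX fX)[e Xe /ZM Me]] := Zc _ (MP _ (conj Mp Pp)) Pp.
  exact: nX' Me.
apply: (nX' _ Xe); apply: Mx => // [|X' f _ X'C X'e X'f].
  by rewrite /lsrc /=; exact: sep_src sX Xe.
by apply: nX'; rewrite (inC_eq (sep_inC sX) X'C Xe X'e).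
Qed.

(* The translate x^-1 W. *)
Definition trans x W : set (gpath E) :=
  [set p | [/\ p.1 = lrng x, reduced p.2 & W (lsrc x, red (x :: p.2))]].

Lemma red_actx x p w :
  (lsrc x, red (x :: (act p w).2)) = act (lsrc x, red (x :: p.2)) w.
Proof.
by congr (_, _); rewrite red_catl -[LHS]/(red ([:: x] ++ red (p.2 ++ w))) red_catr.
Qed.

Lemma red_linv x w : reduced w -> red (linv x :: red (x :: w)) = w.
Proof.
move=> rw; rewrite -cat1s red_catr /= red_id // -{2}[x]linvK cons_redK //.
Qed.

Lemma red_linvK x w : reduced w -> red (x :: red (linv x :: w)) = w.
Proof. by move=> rw; have := red_linv (linv x) rw; rewrite linvK. Qed.

Lemma trans_prng x W p : tree (lsrc x) W -> trans x W p ->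
  walk (lrng x) p.2 /\ prng p = prng (lsrc x, red (x :: p.2)).
Proof.
move=> tW [p1 rp Wp]; have /= wx := tree_walk tW Wp.
have : walk (lrng x) (linv x :: red (x :: p.2)).
  by rewrite /= lsrc_linv lrng_linv.
move=> /walk_red[]; rewrite red_linv // => wp pp; split => //.
by case: (p) p1 pp => u w /= -> ->; rewrite /prng /= lrng_linv.
Qed.

(** Left multiplication by [x] carries neighbours to neighbours, which settles the edge condition.
    Closure under prefixes needs care, since moving the root may exchange parent and child. *)
Lemma trans_tree x W : tree (lsrc x) W -> W (lsrc x, [:: x]) ->
  tree (lrng x) (trans x W).
Proof.
move=> tW Wx; have [W0 WF Wr Ws] := tW; split.
- by split.
- by move=> p Tp; have [? ? _] := Tp; have [] := trans_prng tW Tp.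
- move=> u w y [/= uE rwy Wwy]; split => //=.
    by rewrite -cats1 in rwy; exact: reduced_catl rwy.
  have Wxw : W (act (lsrc x, red (x :: w)) [:: y]).
    by rewrite -(red_actx _ (u, w)) act_rcons.
  move: Wxw; rewrite /act /= cats1 -/(red (x :: w)).
  case: (red_rconsP y (red_reduced (x :: w))) => [w' rE Ww'|_].
    have rw : reduced w by rewrite -cats1 in rwy; exact: reduced_catl rwy.
    (* If [y] cancels the last letter of x w, then [w] is empty: otherwise that letter is the last
       one of [w], and w y is not reduced. For empty [w] the node is the path [x], in [W] by
       assumption. *)
    case/lastP: w rwy rw rE {Wwy} => [|w z] rwy rw //= rE.
    move: rwy; rewrite reduced_rcons; case: eqP => // yz _; exfalso.
    move: rE; rewrite -/(red (rcons w z)) red_id //.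
    case: w rw {Ww'} => [|t w] rw /=.
      case: eqP => _; first by move/(congr1 size); rewrite size_rcons.
      by move=> /(congr1 (last x)); rewrite last_rcons /= => zE; apply: yz;
        rewrite zE linvK.
    by case: eqP => _ /(congr1 (last x)); rewrite /= !last_rcons => zE;
      apply: yz; rewrite zE linvK.
  by move=> Wwy'; apply: (Wr _ _ y).
move=> p X e f [p1 rp Wp] XC Xe Xf [_ _ We] [_ _ Wf].
by rewrite !red_actx in We Wf; exact: Ws Wp XC Xe Xf We Wf.
Qed.

Lemma trans_complete K x W : tree (lsrc x) W -> W (lsrc x, [:: x]) ->
  complete K W -> complete K (trans x W).
Proof.
move=> tW Wx cW p Tp; have [p1 rp Wp] := Tp; have [_ pE] := trans_prng tW Tp.
have [cn cX] := cW _ Wp; split=> [e ep|X sX KX].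
  by split=> //; [exact: act_reduced|rewrite red_actx; apply: cn; rewrite ep].
rewrite pE in sX; have [e Xe We] := cX _ sX KX.
by exists e => //; split=> //; [exact: act_reduced|rewrite red_actx].
Qed.

Lemma trans_linv x W : tree (lsrc x) W -> trans (linv x) (trans x W) = W.
Proof.
move=> tW; apply/seteqP; split=> p.
  move=> [p1 rp [_ _]]; rewrite [(_, _).2]/= red_linvK //.
  by rewrite -(lrng_linv x) -p1; case: (p).
move=> Wp; have [p1 rp] := (tree_root tW Wp, tree_reduced tW Wp).
split; rewrite ?lrng_linv //; split; rewrite ?lsrc_linv //;
  first exact: red_reduced.
by rewrite [(_, _).2]/= red_linvK // -p1; case: (p) Wp.
Qed.

(** * The Leavitt model of a complete tree *)

Lemma lbigP x : lbig x <-> ~ lneutral x.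
Proof.
split=> [[xp [X [XC Xx [e [f [Xe Xf ef]]]]]] [xn|xC]|xn]; first by rewrite xn in xp.
  by move: Xe Xf; rewrite (inC_eq XC xC Xx erefl) => ex fx; apply: ef;
    rewrite ex fx.
have xp : x.2 by case xE: x.2 => //; case: xn; left.
split=> //; have [X sX Xx] := sep_ex x.1; exists X; split=> //;
  first exact: sep_inC sX.
apply: contrapT => nm; apply: xn; right;
  suff <- : X = [set x.1] by exact: sep_inC sX.
apply/seteqP; split=> [e Xe|_ ->] //; apply: contrapT => ex.
by apply: nm; exists e, x.1.
Qed.

Lemma multi_big X e : inC X -> multi X -> X e -> lbig (pos e).
Proof. by move=> XC mX Xe; split=> //; exists X. Qed.

Lemma infinite_multi X : infinite_set X -> multi X.
Proof.
move=> iX; apply: contrapT => nm; apply: iX.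
have [->|/set0P[e Xe]] := eqVneq X set0; first exact: finite_set0.
apply: (@sub_finite_set _ _ [set e]) => [f Xf|]; last exact: finite_set1.
by apply: contrapT => fe; apply: nm; exists f, e.
Qed.

(** These are the paths p with p_L = p. *)
Definition bigend p : Prop := p.2 = [::] \/ exists w x, p.2 = rcons w x /\ lbig x.

Lemma bigendP p : bigend p <-> forall w x, p.2 = rcons w x -> ~ lneutral x.
Proof.
split=> [[->|[w [x [pE /lbigP bx]]]] w' x' |pn]; first by case: w'.
  by rewrite pE => /rcons_inj[_ <-].
rewrite /bigend; case/lastP: p.2 pn => [|w x] pn; [by left|right].
by exists w, x; split=> //; apply/lbigP/(pn w).
Qed.

Lemma FL_tree v Z : FL v Z <->
  tree v Z /\ forall z, Z z -> exists z', [/\ Z z', pprefix z z' & bigend z'].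
Proof.
split=> [[Z0 ZF Zd Zc Ze]|[tZ Ze]].
  split; first exact: compatible_tree.
  by move=> z /Ze[z' [Zz' zz' be]]; exists z'; split=> //; apply/bigendP.
split; first by exists (v, [::]); case: tZ.
- exact: tree_FC.
- exact: lowerset_sub (tree_lowerset tZ) _.
- by move=> p q; exact: (tree_compatible tZ).
by move=> z /Ze[z' [Zz' zz' /bigendP be]]; exists z'.
Qed.

Lemma pprefix_refl p : pprefix p p.
Proof. by split=> //; exact: prefix_refl. Qed.

Lemma FC_walk p : FCall p -> walk p.1 p.2. Proof. by case. Qed.

Lemma FC_reduced p : FCall p -> reduced p.2. Proof. by case. Qed.

Lemma FC_prefix v w1 w2 : FCall (v, w1 ++ w2) -> FCall (v, w1).
Proof.
move=> [_ /= /walk_cat[ww _] rw sw]; split=> //=; first exact: reduced_catl rw.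
move=> X e f XC Xe Xf [u [u' wE]]; apply: (sw X e f) => //.
by exists u, (u' ++ w2); rewrite wE -catA.
Qed.

Lemma FC_suffix v w1 w2 : FCall (v, w1 ++ w2) -> FCall (prng (v, w1), w2).
Proof.
move=> [_ /= /walk_cat[_ ww] rw sw]; split=> //=; first exact: reduced_catr rw.
move=> X e f XC Xe Xf [u [u' wE]]; apply: (sw X e f) => //.
by exists (w1 ++ u), u'; rewrite wE -catA.
Qed.

Lemma FC_neg p e : FCall p -> rng e = prng p -> reduced (rcons p.2 (neg e)) ->
  FCall (p.1, rcons p.2 (neg e)).
Proof.
case: p => v w [_ /= ww rw sw] ep rwe; split=> //=; first exact/walk_rcons.
move=> X g f XC Xg Xf [u [u' wE]]; apply: (sw X g f XC Xg Xf).
case/lastP: u' wE => [|u' y].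
  by rewrite -[[:: _; _]]/([:: neg g] ++ [:: pos f]) catA cats1 => /rcons_inj[].
by rewrite -!rcons_cons -rcons_cat => /rcons_inj[-> _]; exists u, u'.
Qed.

Lemma FC_sep v w X e f w' : FCall (v, w ++ [:: neg e, pos f & w']) ->
  inC X -> X e -> X f -> False.
Proof. by move=> [_ _ _ sw] XC Xe Xf; apply: (sw X e f XC Xe Xf); exists w, w'. Qed.

(** [Lof] passes from a complete tree to its Leavitt model and [Wof] back; [LofWof] and [WofLof]
    show that they are mutually inverse. *)
Definition Lof W : set (gpath E) := Defs.down [set q | exists2 g, W g & Lpart g q].

Definition Wof Z : set (gpath E) :=
  [set p | FCall p /\ exists q w, [/\ Z q, p = (q.1, q.2 ++ w) & all_neutral w]].

Lemma all_neutral_cat w1 w2 : all_neutral (w1 ++ w2) <-> all_neutral w1 /\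
  all_neutral w2.
Proof.
split=> [an|[an1 an2] x]; last by rewrite mem_cat => /orP[/an1|/an2].
by split=> x xw; apply: an; rewrite mem_cat xw ?orbT.
Qed.

Lemma all_neutral_rcons w x : all_neutral (rcons w x) <-> all_neutral w /\
  lneutral x.
Proof.
rewrite -cats1 all_neutral_cat; split=> -[? h]; split=> //; first exact/h/mem_head.
by move=> y; rewrite inE => /eqP ->.
Qed.

Lemma Lpart_ex p : exists q, Lpart p q.
Proof.
case: p => v w; elim/last_ind: w => [|w x [q [w' [[vE wE] nw bq]]]].
  by exists (v, [::]), [::]; split=> //; left.
have [nx|/lbigP bx] := pselect (lneutral x).
  exists q, (rcons w' x); split=> //; last exact/all_neutral_rcons.
  by rewrite -rcons_cat -wE vE.
exists (v, rcons w x), [::]; split=> //=; first by rewrite cats0.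
by right; exists w, x.
Qed.

Lemma LofP W q : lowerset W ->
  Lof W q <-> exists q', [/\ W q', pprefix q q' & bigend q'].
Proof.
move=> lW; split=> [[q' [g Wg [w [gE nw bq']]] qq']|[q' [Wq' qq' bq']]].
  exists q'; split=> //; case: q' gE {qq' bq'} => v' w' gE.
  by apply: (lowerset_cat lW (w2 := w)); rewrite gE in Wg.
exists q' => //; exists q' => //; exists [::]; split=> //.
by rewrite cats0; case: q' {Wq' qq' bq'}.
Qed.

Lemma Lof_sub W : lowerset W -> Lof W `<=` W.
Proof.
move=> lW q /(LofP _ lW)[q' [Wq' qq' _]].
by apply: (@lowerset_sub W W) => //; exists q'.
Qed.

Lemma Lof_bigend W q : lowerset W -> W q -> bigend q -> Lof W q.
Proof.
by move=> lW Wq bq; apply/LofP => //; exists q; split=> //; exact: pprefix_refl.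
Qed.

Lemma FL_sub v Z : tree v Z ->
  forall Z', Z' `<=` Z -> Z' !=set0 -> lowerset Z' ->
  (forall z, Z' z -> exists z', [/\ Z' z', pprefix z z' & bigend z']) -> FL v Z'.
Proof.
move=> tZ Z' ZZ [[u w] Zq] lZ Ze; apply/FL_tree; split=> //.
apply: (tree_sub tZ) => //; have /= <- := tree_root tZ (ZZ _ Zq).
exact: (lowerset_cat (w1 := [::]) lZ Zq).
Qed.

Lemma FL_Lof v W : tree v W -> FL v (Lof W).
Proof.
move=> tW; have lW := tree_lowerset tW.
apply: (FL_sub tW); first exact: Lof_sub.
- by exists (v, [::]); apply: Lof_bigend => //; [case: tW|left].
- exact: lowerset_down.
move=> z /(LofP _ lW)[z' [Wz' zz' bz']]; exists z'; split=> //.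
exact: Lof_bigend.
Qed.

(** Every inverse edge is present at a node of a complete tree, and a finite class {e} leaves no
    choice but e. *)
Lemma neutral_follow v W q w : tree v W -> complete finite_set W ->
  W q -> walk q.1 (q.2 ++ w) -> reduced (q.2 ++ w) -> all_neutral w ->
  W (q.1, q.2 ++ w).
Proof.
move=> tW cW Wq; elim/last_ind: w => [|w x IH] ww rw nw.
  by rewrite cats0; case: q {ww rw} Wq.
move: nw; rewrite -rcons_cat in ww rw *; move=> /all_neutral_rcons[nw nx].
have /walk_rcons[ww' xE] := ww; have rw' := rw; rewrite -cats1 in rw'.
have Ww := IH ww' (reduced_catl rw') nw; have [cn cX] := cW _ Ww.
rewrite -act_rcons //; case: x nx xE {ww rw rw'} => e [] /= nx xE; last exact: cn.
case: nx => // eC; have [X sX Xe] := sep_ex e.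
have XE : X = [set e] := inC_eq (sep_inC sX) eC Xe erefl.
rewrite XE -[src e]/(lsrc (e, true)) xE in sX;
  have [f -> //] := cX _ sX (finite_set1 e).
Qed.

(** Let g u y be a finite exit, [u] neutral and [y] in [X]. Then g u is in [W], so some e in [X]
    occurs there. If g u ends in e^-1, the exit is not separated. Otherwise g u e is in the model,
    the edge condition gives e = y, and the first letter after g does not leave the model. *)
Lemma Lof_noexit v W : tree v W -> complete finite_set W -> NLfin (Lof W) = set0.
Proof.
move=> tW cW; have lW := tree_lowerset tW; apply/seteqP; split=> // p.
move=> [pF [g [x [w [Lg [_ [u [y [X /= [wE nu XC Xy [mX fX]]]]]] pE nL [v'
  FLp]]]]]].
have Wg := Lof_sub lW Lg; apply: nL; rewrite wE -rcons_cat in pE.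
have FCgu : FCall (g.1, g.2 ++ u).
  by apply: (@FC_prefix _ _ [:: pos y]); rewrite cats1 -pE.
have Wgu : W (g.1, g.2 ++ u).
  by apply: (neutral_follow tW cW) => //;
    [exact: FC_walk FCgu|exact: FC_reduced FCgu].
have sX : sep (prng (g.1, g.2 ++ u)) X.
  have /= := FC_walk pF; rewrite pE /= => /walk_rcons[_ <-].
  exact: inC_sep.
have [_ /(_ X sX fX)[e Xe We]] := cW _ Wgu.
have /FL_tree[tLp _] := FLp; move: We; rewrite /act /= cats1.
case: red_rconsP => [|w' guE _|re We]; first exact: FC_reduced FCgu.
  exfalso; apply: (@FC_sep g.1 w' X e y [::]) => //.
  by rewrite -[[:: _; _]]/([:: neg e] ++ [:: pos y]) catA !cats1 -guE -pE.
have Le : Lof W (g.1, rcons (g.2 ++ u) (pos e)).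
  by apply: Lof_bigend => //; right; exists (g.2 ++ u), (pos e); split=> //;
    exact: multi_big mX Xe.
suff ey : e = y.
  move: Le; rewrite ey rcons_cat -wE -cat_rcons.
  by apply: lowerset_cat; exact: lowerset_down.
have ep : act (g.1, g.2 ++ u) [:: pos y] = p.
  by rewrite act_rcons ?pE //; have := FC_reduced pF; rewrite pE.
have [_ _ _ Ls] := tLp; apply: (Ls (g.1, g.2 ++ u) X) => //.
- by right; exists p => //; rewrite pE; split=> //=; exact: prefix_rcons.
- by left; rewrite act_rcons.
- by right; rewrite ep; exact: downW.
Qed.

(** * Exits and the reconstruction of the complete tree *)

Lemma exit_point Z v w1 w : Z (v, w1) -> ~ Z (v, w1 ++ w) ->
  exists w2 x w3, [/\ w = w2 ++ x :: w3, Z (v, w1 ++ w2)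
    & ~ Z (v, rcons (w1 ++ w2) x)].
Proof.
elim: w w1 => [|x w IH] w1 Zw1; first by rewrite cats0.
have [Zx|nZx] := pselect (Z (v, rcons w1 x)).
  rewrite -cat_rcons => /(IH _ Zx)[w2 [y [w3 [-> Z2 nZ]]]].
  by exists (x :: w2), y, w3; split=> //; rewrite -cat_rcons.
by exists [::], x, w; rewrite cats0.
Qed.

(** [NL] asks that the letter after g leave [Z], so g is the node from which the path leaves [Z],
    possibly beyond [q]. The ambient tree [M] shows that adjoining the path to [Z] gives a tree
    again. *)
Lemma NL_intro (K : set (edge E) -> Prop) v Z M q w e X : FL v Z -> tree v M ->
  Z `<=` M ->
  M (q.1, q.2 ++ rcons w (pos e)) -> Z q -> all_neutral w ->
  inC X -> X e -> K X -> multi X -> ~ Z (q.1, q.2 ++ rcons w (pos e)) ->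
  NL K Z (q.1, q.2 ++ rcons w (pos e)).
Proof.
set r := (_, _) => FZ tM ZM Mr Zq nu XC Xy KX mX nZr.
have [tZ Ze] := (FL_tree _ _).1 FZ; have rF : FCall r.
  by have := tree_FC tM Mr; rewrite /FCall /= (tree_root tZ Zq).
split=> //; have Zq' : Z (q.1, q.2) by case: (q) Zq.
have [w2 [x [w3 [wE Z2 nZ2]]]] := exit_point Zq' nZr.
exists (q.1, q.2 ++ w2), x, w3; split=> //.
- split; first by apply: (@FC_suffix q.1); rewrite -catA -wE.
  case/lastP: w3 wE => [|w3 z] wE; rewrite ?cats1 -?rcons_cons -?rcons_cat in wE.
    by have [_ <-] := rcons_inj wE; exists [::], e, X; split.
  have [uE <-] := rcons_inj wE; exists (x :: w3), e, X; split=> //.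
  by move: nu; rewrite uE all_neutral_cat => -[].
- by rewrite /r wE catA.
exists v; apply: (FL_sub tM).
- rewrite subUset; split=> //; apply: lowerset_sub (tree_lowerset tM) _ => _ ->//.
- by exists q; left.
- move=> a w1 z [Zz|Dz]; [left; exact: tree_lowerset tZ _ _ _ Zz|right].
  exact: lowerset_down Dz.
move=> z [/Ze[z' [Zz' zz' bz']]|[_ -> zr]]; first by exists z'; split=> //; left.
exists r; split=> //; first by right; exact: downW.
by right; exists (q.2 ++ w), (pos e); rewrite rcons_cat; split=> //;
  exact: multi_big mX Xy.
Qed.

Lemma FL_sub_Wof v Z : FL v Z -> Z `<=` Wof Z.
Proof.
move=> /FL_tree[tZ _] p Zp; split; last by exists p, [::]; split=> //;
  rewrite cats0; case: (p).
by have := tree_FC tZ Zp; rewrite /FCall /= (tree_root tZ Zp).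
Qed.

(** A nonempty neutral tail would make the last letter of [p] neutral. *)
Lemma Wof_bigend v Z p : FL v Z -> Wof Z p -> bigend p -> Z p.
Proof.
move=> /FL_tree[tZ _] [_ [q [w [Zq -> nw]]]].
case/lastP: w nw => [|w x] nw; first by rewrite cats0; case: (q) Zq.
case=> [/= /(congr1 size)|[w' [y [/= + /lbigP by']]]].
  by rewrite size_cat size_rcons addnS.
rewrite -rcons_cat => /rcons_inj[_ xy]; case: by'.
by rewrite -xy; apply: nw; rewrite mem_rcons mem_head.
Qed.

Lemma FL_lowerset v Z : FL v Z -> lowerset Z.
Proof. by move=> /FL_tree[/tree_lowerset]. Qed.

(** For the edge condition let e and f be distinct in [X]. A neighbour of [p] along e is the parent,
    when p ends in e^-1, or a child, which ends in an edge of a class with several elements and so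
    lies in [Z]. Two parents force e = f, a parent and a child give a subpath e^-1 f, and two
    children contradict the edge condition of [Z]. *)
Lemma Wof_tree v Z : FL v Z -> tree v (Wof Z).
Proof.
move=> FZ; have [tZ Ze] := (FL_tree _ _).1 FZ.
have WF p : Wof Z p -> FC v p.
  by move=> [+ [q [w [Zq pE _]]]]; rewrite /FCall /= pE (tree_root tZ Zq).
split.
- by apply: FL_sub_Wof FZ _ _; case: tZ.
- by move=> p /WF[].
- move=> a w x [Fx [q [w' [Zq qE nw']]]]; split.
    by apply: (@FC_prefix _ _ [:: x]); rewrite cats1.
  case/lastP: w' nw' qE => [|w' y] nw' [aE wE].
    exists (a, w), [::]; split=> //; rewrite ?cats0 //.
    apply: (tree_lowerset tZ (x := x)); rewrite wE cats0 aE.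
    by case: (q) Zq.
  move: wE; rewrite -rcons_cat => /rcons_inj[wE _].
  exists q, w'; split=> //; first by rewrite aE wE.
  by move: nw'; rewrite all_neutral_rcons => -[].
move=> p X e f Wp XC Xe Xf We Wf; apply: contrapT => ef.
have mX : multi X by exists e, f.
have pc g : X g -> Wof Z (act p [:: pos g]) ->
    (exists w, p.2 = rcons w (neg g)) \/
    act p [:: pos g] = (p.1, rcons p.2 (pos g)) /\ Z (act p [:: pos g]).
  move=> Xg; rewrite /act /= cats1.
  case: red_rconsP; first by have [/FC_reduced] := Wp.
    by move=> w pE _; left; exists w.
  move=> _ Wg; right; split=> //; apply: (Wof_bigend FZ Wg).
  by right; exists p.2, (pos g); split=> //; exact: multi_big mX Xg.
have contra g h w : X g -> X h -> p.2 = rcons w (neg g) ->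
    act p [:: pos h] = (p.1, rcons p.2 (pos h)) -> Wof Z (act p [:: pos h]) ->
      False.
  move=> Xg Xh pE -> [F _]; apply: (@FC_sep p.1 w X g h [::]) => //.
  by rewrite pE -!cats1 -catA in F.
have [[w pe]|[ee Ze']] := pc _ Xe We.
  have [[w' pf]|[ff Zf']] := pc _ Xf Wf; last exact: contra pe ff Wf.
  by apply: ef; move: pf; rewrite pe => /rcons_inj[_ []].
have [[w pf]|[ff Zf']] := pc _ Xf Wf; first exact: contra pf ee We.
have Zp : Z p.
  by rewrite ee in Ze'; have := tree_lowerset tZ Ze'; case: (p).
have [_ _ _ Zs] := tZ; exact: ef (Zs p X e f Zp XC Xe Xf Ze' Zf').
Qed.

(** Inverse edges and the edge of a one-element class are neutral, so they can be appended to any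
    path of [Wof Z]. If a finite class with several elements has no edge at [p], then p e is a
    finite exit for each of its edges e. *)
Lemma Wof_complete v Z : FL v Z -> NLfin Z = set0 -> complete finite_set (Wof Z).
Proof.
move=> FZ nZ; have tW := Wof_tree FZ; have [tZ _] := (FL_tree _ _).1 FZ.
move=> p Wp; have [Fp [q [w [Zq pE nw]]]] := Wp; split=> [e ep|X sX fX].
  apply: contrapT => nW; have [re aE] := tree_act tW Wp nW.
  apply: nW; rewrite aE; split; first exact: FC_neg.
  exists q, (rcons w (neg e)); split=> //; first by rewrite pE rcons_cat.
  by apply/all_neutral_rcons; split=> //; left.
apply: contrapT => nX.
have nW e : X e -> ~ Wof Z (act p [:: pos e]) by move=> Xe We; apply: nX; exists e.
have [e Xe] := sep_nonempty sX; have [re aE] := tree_act tW Wp (nW _ Xe).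
have XC := sep_inC sX.
(* As no edge of [X] occurs at [p], adjoining p e gives a tree. It shows that p e is separated and
   serves as the ambient tree in [NL_intro]. *)
have tM : tree v (Wof Z `|` [set act p [:: pos e]]).
  apply: tree_extend => //; [exact: sep_src sX Xe|exact: nW|].
  by move=> X' f _ X'C X'e X'f; apply: nW; rewrite (inC_eq XC X'C Xe X'e).
have FCr : FCall (p.1, rcons p.2 (pos e)).
  rewrite -aE; have := tree_FC tM (or_intror erefl); rewrite /FCall /=.
  by rewrite (tree_root tW Wp).
have [mX|nmX] := pselect (multi X); last first.
  apply: (nW _ Xe); rewrite aE; split=> //; exists q, (rcons w (pos e)).
  split=> //; first by rewrite pE rcons_cat.
  apply/all_neutral_rcons; split=> //; right => /=.
  suff <- : X = [set e] by []; apply/seteqP; split=> [f Xf|_ ->] //.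
  by apply: contrapT => fe; apply: nmX; exists f, e.
suff : NLfin Z (q.1, q.2 ++ rcons w (pos e)) by rewrite nZ.
have rE : (q.1, q.2 ++ rcons w (pos e)) = act p [:: pos e].
  by rewrite aE pE rcons_cat.
apply: (NL_intro FZ tM (X := X)) => //; last 1 first.
- by rewrite rE => /(FL_sub_Wof FZ); exact: nW Xe.
- by move=> z /(FL_sub_Wof FZ); left.
- by right.
Qed.

Lemma LofWof v Z : FL v Z -> Lof (Wof Z) = Z.
Proof.
move=> FZ; have [tZ Ze] := (FL_tree _ _).1 FZ.
have lW := tree_lowerset (Wof_tree FZ).
apply/seteqP; split=> p.
  move=> /(LofP _ lW)[p' [Wp' pp' bp']]; apply: (@lowerset_sub Z Z) => //.
    exact: tree_lowerset tZ.
  by exists p' => //; exact: Wof_bigend FZ Wp' bp'.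
move=> /Ze[p' [Zp' pp' bp']]; apply/(LofP _ lW); exists p'; split=> //.
exact: FL_sub_Wof FZ _ Zp'.
Qed.

Lemma WofLof v W : tree v W -> complete finite_set W -> Wof (Lof W) = W.
Proof.
move=> tW cW; have lW := tree_lowerset tW; apply/seteqP; split=> p.
  move=> [Fp [q [w [/(Lof_sub lW) Wq pE nw]]]]; rewrite pE.
  by apply: (neutral_follow tW cW) => //; have [] := Fp; rewrite pE.
move=> Wp; split.
  by have := tree_FC tW Wp; rewrite /FCall /= (tree_root tW Wp).
have [q [w [pE nw bq]]] := Lpart_ex p; exists q, w; split=> //.
apply: Lof_bigend => //.
by rewrite pE in Wp; have := lowerset_cat lW Wp; case: (q).
Qed.

(** Deciding membership in the complete tree by the single path p_L is what makes the reconstruction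
    continuous. *)
Lemma Wof_Lpart v Z p q : FL v Z -> FCall p -> Lpart p q -> Wof Z p <-> Z q.
Proof.
move=> FZ Fp pq; have [w [pE nw bq]] := pq; split=> [Wp|Zq]; last first.
  by split=> //; exists q, w.
apply: (Wof_bigend FZ) => //.
rewrite pE in Wp; have lW := tree_lowerset (Wof_tree FZ).
by have := lowerset_cat lW Wp; case: (q).
Qed.

(** * Basic neighbourhoods in the Leavitt model *)

Lemma finite_down (T : set (gpath E)) : finite_set T -> finite_set (Defs.down T).
Proof.
move=> fT; have -> : Defs.down T = \bigcup_(q in T)
    [set (q.1, take n q.2) | n in [set n | (n < (size q.2).+1)%N]].
  apply/seteqP; split=> [[u w] [q Tq [/= -> wq]]|_ [q Tq [n _ <-]]].
    exists q => //; exists (size w); first by rewrite /= ltnS size_prefix.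
    by move/prefixP: wq => [s ->]; rewrite take_size_cat.
  by exists q => //; split=> //=; exact: prefix_take.
apply: bigcup_finite => // q _; apply: finite_image; exact: finite_II.
Qed.

Lemma FL_down v Z z : tree v Z -> Z z -> bigend z -> FL v (Defs.down [set z]).
Proof.
move=> tZ Zz bz; apply: (FL_sub tZ); last 2 first.
- exact: lowerset_down.
- by move=> y [_ -> pz]; exists z; split=> //; exact: downW.
- by apply: lowerset_sub => [|_ ->//]; exact: tree_lowerset tZ.
- by exists z; exact: downW.
Qed.

Lemma XL_down v Z z : tree v Z -> Z z -> bigend z -> XL (Defs.down [set z]).
Proof.
move=> tZ Zz bz; split; first by exists v; exact: (FL_down tZ).
exact/finite_down/finite_set1.
Qed.

(** The path [q] is followed in the complete tree of [Z] up to the node w1 where it leaves. The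
    leaving letter is an edge e, since inverse edges are never missing. If another edge f of its
    class occurs at w1, requiring w1 f excludes [q]; otherwise the class is infinite and w1 e is put
    into [F]. A wrong source is excluded by requiring the root of [Z]. *)
Lemma TL_separate v Z q : FL v Z -> NLfin Z = set0 -> FCall q -> bigend q -> ~
  Z q ->
  exists T F, [/\ XL T, finite_set F, F `<=` NLinf T, ZL T F Z
    & forall Z', ZL T F Z' -> ~ Z' q].
Proof.
move=> FZ nZ Fq bq nq; have [tZ Ze] := (FL_tree _ _).1 FZ; have [Z0 _ _ _] := tZ.
have ZLdown z : Z z -> bigend z -> ZL (Defs.down [set z]) set0 Z.
  move=> Zz bz; split; first by exists v.
  split; last exact: set0I.
  by apply: lowerset_sub => [|_ ->//]; exact: tree_lowerset tZ.
have [qv|qv] := pselect (q.1 = v); last first.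
  have b0 : bigend (v, [::]) by left.
  exists (Defs.down [set (v, [::])]), set0; split=> //;
    first exact: XL_down tZ Z0 b0.
    exact: ZLdown.
  move=> Z' [[v' /FL_tree[tZ' _]] [TZ _]] Z'q.
  apply: qv; rewrite (tree_root tZ' Z'q) -(tree_root tZ' (TZ _ (downW erefl))).
  by [].
case: q qv Fq bq nq => _ w /= -> Fq bq nq.
have tW := Wof_tree FZ; have cW := Wof_complete FZ nZ; have [W0 _ _ _] := tW.
have nWq : ~ Wof Z (v, [::] ++ w) by move=> /(Wof_bigend FZ)/(_ bq).
have [w1 [y [w2 [/= wE W1 nW]]]] := exit_point W0 nWq.
have Fy : FCall (v, rcons w1 y).
  by apply: (@FC_prefix _ _ w2); rewrite cat_rcons -wE.
have aE : act (v, w1) [:: y] = (v, rcons w1 y).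
  by rewrite act_rcons //; exact: FC_reduced Fy.
have /walk_rcons[_ yE] := FC_walk Fy; have [cn cX] := cW _ W1.
have Zy Z' : FLall Z' -> Z' (v, w) -> Z' (v, rcons w1 y).
  move=> [v' /FL_lowerset lZ'] Z'w.
  by apply: (lowerset_cat (w2 := w2) lZ'); rewrite cat_rcons -wE.
case: y => e [] in wE nW Fy aE yE Zy; last by case: nW; rewrite -aE; exact: cn.
have [X sX Xe] := sep_ex e; have XC := sep_inC sX.
rewrite -[src e]/(lsrc (pos e)) yE in sX.
have [[f Xf Wf]|nX] := pselect (exists2 f, X f & Wof Z (act (v, w1) [:: pos f])).
  have ef : e <> f by move=> ef; apply: nW; rewrite -aE ef.
  have mX : multi X by exists e, f.
  move: (Wf); rewrite /act /= cats1; case: red_rconsP.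
  - exact: tree_reduced tW W1.
  - move=> w' w1E _; exfalso; apply: (@FC_sep v w' X f e [::]) => //.
    by rewrite w1E -!cats1 -catA in Fy.
  move=> rf Wrf; have bf : bigend (v, rcons w1 (pos f)).
    by right; exists w1, (pos f); split=> //; exact: multi_big mX Xf.
  have Zf := Wof_bigend FZ Wrf bf.
  exists (Defs.down [set (v, rcons w1 (pos f))]), set0; split=> //.
  - exact: XL_down tZ Zf bf.
  - exact: ZLdown.
  move=> Z' [FZ' [TZ _]] /(Zy _ FZ') Z'e; have [v' /FL_tree[tZ' _]] := FZ'.
  have Z'f := TZ _ (downW erefl); have [_ _ _ Zs] := tZ'.
  apply: ef; apply: (Zs (v, w1) X) => //; first exact: (tree_lowerset tZ' Z'f).
    by rewrite aE.
  by rewrite act_rcons.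
have iX : infinite_set X by move=> fX; apply: nX; exact: cX.
have mX := infinite_multi iX.
have tM : tree v (Wof Z `|` [set act (v, w1) [:: pos e]]).
  apply: tree_extend => //; first by rewrite aE.
  move=> X' f _ X'C X'e X'f Wf; apply: nX; exists f => //.
  by rewrite (inC_eq XC X'C Xe X'e).
(* The node w1 is z u with [z] in [Z] and [u] neutral. Extending [z] to [z'] makes the prefixes of
   [z'] a member of [XL], of which w1 e is an infinite exit. *)
have [_ [z [u [Zz [zv w1E] nu]]]] := W1.
have [z' [Zz' zz' bz']] := Ze _ Zz.
have FT := FL_down tZ Zz' bz'; have TZ : Defs.down [set z'] `<=` Z.
  by apply: lowerset_sub => [|_ ->//]; exact: tree_lowerset tZ.
have rE : (v, rcons w1 (pos e)) = (z.1, z.2 ++ rcons u (pos e)).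
  by rewrite w1E -zv rcons_cat.
exists (Defs.down [set z']), [set (v, rcons w1 (pos e))]; split=> //.
- exact: XL_down tZ Zz' bz'.
- move=> _ ->; rewrite rE; apply: (NL_intro FT tM (X := X)) => //; last 1 first.
  + by rewrite -rE => /TZ/(FL_sub_Wof FZ).
  + by move=> p /TZ/(FL_sub_Wof FZ); left.
  + by rewrite -rE -aE; right.
  + by exists z'.
- split; first by exists v.
  split=> //; apply/seteqP; split=> // _ [-> /(FL_sub_Wof FZ)]; exact: nW.
move=> Z' [FZ' [_ FI]] /(Zy _ FZ') Z'r.
have : ([set (v, rcons w1 (pos e))] `&` Z') (v, rcons w1 (pos e)) by [].
by rewrite FI.
Qed.

Lemma NL_bigend Z (f : gpath E) : NLinf Z f -> bigend f.
Proof.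
move=> [_ [g [x [w [_ [_ [u [y [X [wE _ XC Xy iX]]]]] -> _ _]]]]]; right.
exists (g.2 ++ u), (pos y); rewrite /= in wE; rewrite /= wE -rcons_cat; split=> //.
exact: multi_big (infinite_multi iX) Xy.
Qed.

(** The union of [T1] and [T2] is a subtree of [Z]. A path of [F1] or [F2] may be incompatible with
    this union and then is not one of its exits. Such paths are dropped: no member of [FLall]
    containing the union contains them. *)
Lemma ZL_setI v Z T1 F1 T2 F2 : FL v Z -> XL T1 -> XL T2 ->
  finite_set F1 -> finite_set F2 -> F1 `<=` NLinf T1 -> F2 `<=` NLinf T2 ->
  ZL T1 F1 Z -> ZL T2 F2 Z ->
  exists T F, [/\ XL T, finite_set F, F `<=` NLinf T, ZL T F Z
    & ZL T F `<=` ZL T1 F1 `&` ZL T2 F2].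
Proof.
move=> FZ [[v1 FT1] fT1] [[v2 FT2] fT2] fF1 fF2 F1N F2N [_ [T1Z F1Z]] [_ [T2Z F2Z]].
have [tZ _] := (FL_tree _ _).1 FZ.
have [tT1 e1] := (FL_tree _ _).1 FT1; have [tT2 e2] := (FL_tree _ _).1 FT2.
pose T := T1 `|` T2; have TZ : T `<=` Z by rewrite subUset.
have FT : FL v T.
  apply: (FL_sub tZ) => //.
  - by exists (v1, [::]); left; case: tT1.
  - by move=> a w x [/(tree_lowerset tT1)|/(tree_lowerset tT2)]; [left|right].
  move=> z [/e1|/e2] [z' [Tz' zz' bz']]; exists z'; split=> //; [by left|by right].
pose F := [set f | (F1 `|` F2) f /\ FLall (T `|` Defs.down [set f])].
have FZ0 (f : gpath E) : (F1 `|` F2) f -> ~ Z f.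
  by move=> [Ff|Ff] Zf; [rewrite -[False]/(set0 f) -F1Z|rewrite -[False]/(set0
    f) -F2Z].
exists T, F; split.
- by split; [exists v|rewrite /= finite_setU].
- by apply: (@sub_finite_set _ _ (F1 `|` F2)) => [f []//|]; rewrite finite_setU.
- move=> f [Ff [v' /FL_tree[tM _]]].
  have : exists g x w, [/\ T g, NLv (fun X => infinite_set X) (prng g) (prng g,
    x :: w)
      & f = (g.1, g.2 ++ x :: w)].
    by case: Ff => [/F1N|/F2N] [_ [g [x [w [Tg NLg fE _ _]]]]]; exists g, x, w;
      split=> //; [left|right].
  move=> [g [x [w [Tg [_ [u [y [X [/= wE nu XC Xy iX]]]]] fE]]]].
  have v'v : v' = v.
    by rewrite -(tree_root tM (or_introl Tg)) (tree_root tZ (TZ _ Tg)).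
  rewrite v'v in tM; have Mf : (T `|` Defs.down [set f]) f by right; exact: downW.
  have nf : ~ T f by move=> /TZ; exact: FZ0.
  rewrite wE in fE; rewrite fE in tM Mf nf *.
  apply: (NL_intro FT tM (X := X)) => //; exact: infinite_multi.
- split; first by exists v.
  by split=> //; apply/seteqP; split=> // f [[/FZ0]].
move=> Z' [[v' FZ'] [TZ' FZ'0]]; have [tZ' _] := (FL_tree _ _).1 FZ'.
have nF (f : gpath E) : (F1 `|` F2) f -> ~ Z' f.
  move=> Ff Z'f; rewrite -[False]/(set0 f) -FZ'0; split=> //; split=> //; exists v'.
  have bf : bigend f by case: Ff => [/F1N|/F2N]; exact: NL_bigend.
  apply: (FL_sub tZ').
  - rewrite subUset; split=> //.
    by apply: lowerset_sub => [|_ ->//]; exact: tree_lowerset tZ'.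
  - by exists f; right; exact: downW.
  - move=> a w x [Ta|Da]; [left; have [tT _] := (FL_tree _ _).1 FT|right].
      exact: tree_lowerset tT _ _ _ Ta.
    exact: lowerset_down Da.
  move=> z [Tz|[_ -> zf]].
    have [_ /(_ _ Tz)[z' [Tz' zz' bz']]] := (FL_tree _ _).1 FT.
    by exists z'; split=> //; left.
  by exists f; split=> //; right; exact: downW.
have ZLi Ti Fi : Ti `<=` T -> Fi `<=` F1 `|` F2 -> ZL Ti Fi Z'.
  move=> TiT FiF; split; first by exists v'.
  by split; [move=> z /TiT/TZ'|apply/seteqP; split=> // f [/FiF/nF]].
by split; apply: ZLi => z; [left|left|right|right].
Qed.

End Trees.

(** * Characters *)

Section InverseSemigroup.
Local Open Scope group_scope.
Variable S : invSemigroup0Type.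
Implicit Types (x y s t : S) (a b : idem S) (phi : idem S -> bool).

(** Commuting idempotents give y x = x^-1 x and x y = x x^-1, and then y = y x y = x^-1. *)
Lemma sinv_uniq x y : x * y * x = x -> y * x * y = y -> y = sinv x.
Proof.
move=> xyx yxy.
have iyx : (y * x) * (y * x) = y * x by rewrite mulgA yxy.
have ixy : (x * y) * (x * y) = x * y by rewrite mulgA xyx.
have ixx : (x * sinv x) * (x * sinv x) = x * sinv x by exact: sran_subproof.
have isx : (sinv x * x) * (sinv x * x) = sinv x * x by exact: sdom_subproof.
have yx : y * x = sinv x * x.
  have := idemC iyx isx; rewrite !mulgA -(mulgA (y * x)) -(mulgA y).
  rewrite (mulgA x) smulKV => ->.
  by rewrite -(mulgA (sinv x)) -(mulgA (sinv x)) xyx.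
have xy : x * y = x * sinv x.
  by have := idemC ixy ixx; rewrite !mulgA xyx smulKV => ->.
have sxs : sinv x * x * sinv x = sinv x by have := smulKV (sinv x); rewrite sinvK.
by rewrite -yxy yx -mulgA xy mulgA sxs.
Qed.

Lemma sinv_idem x : x * x = x -> sinv x = x.
Proof. by move=> xx; apply/esym/sinv_uniq; rewrite !xx. Qed.

Lemma sran_idem a : sran (val a) = a.
Proof. by apply: val_inj => /=; rewrite -idem_proj //; exact: idemP. Qed.

Variable phi : idem S -> bool.
Hypothesis phiP : spectrum phi.

Lemma phi_mul a b : phi (idem_mul a b) = phi a && phi b.
Proof. by have [_ _] := phiP. Qed.

Lemma phi_sran0 : phi (sran szero) = false.
Proof.
have [_ p0 _] := phiP; rewrite -[RHS]p0; congr phi.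
by apply: val_inj; rewrite /= smul0l.
Qed.

Lemma phi_sranl s t : phi (sran (s * t)) -> phi (sran s).
Proof.
suff -> : sran (s * t) = idem_mul (sran s) (sran (s * t)) by rewrite phi_mul =>
  /andP[].
by apply: val_inj => /=; rewrite sinvM !mulgA smulKV.
Qed.

(** A detour x x^-1 inside a word adds only the condition at its tip s x, since the idempotents
    between [s] and [t] commute. *)
Lemma phi_sran_mid s x t : phi (sran (s * (x * sinv x) * t)) =
  phi (sran (s * x)) && phi (sran (s * t)).
Proof.
rewrite -phi_mul; congr phi; apply: val_inj => /=; rewrite !sinvM sinvK.
have cx : (x * sinv x) * (t * sinv t) = (t * sinv t) * (x * sinv x) by exact:
  sprojC.
have cs : (x * sinv x) * (sinv s * s) = (sinv s * s) * (x * sinv x).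
  by have := sprojC x (sinv s); rewrite sinvK.
transitivity (s * ((x * sinv x) * (t * sinv t)) * sinv s).
  transitivity (s * ((x * sinv x) * ((t * sinv t) * (x * sinv x))) * sinv s).
    by rewrite !mulgA.
  by rewrite -cx (mulgA (x * sinv x)) sran_subproof.
transitivity (s * (((x * sinv x) * (sinv s * s)) * (t * sinv t)) * sinv s).
  by rewrite cs !mulgA smulKV.
by rewrite !mulgA.
Qed.

Lemma spectrum_filter : idem_filter [set a | phi a].
Proof.
have [[a pa] p0 _] := phiP; split; first by exists a.
- by rewrite /= p0.
- by move=> b c /= pb pc; rewrite phi_mul pb.
by move=> b c /= pb bc; move: pb; rewrite -bc phi_mul => /andP[].
Qed.

End InverseSemigroup.

Lemma filter_spectrum (S : invSemigroup0Type) (eta : set (idem S)) :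
  idem_filter eta -> @spectrum S (fun a => `[< eta a >]).
Proof.
move=> [[a ea] e0 eI eS]; split; first by exists a; apply/asboolP.
  exact: asboolF.
move=> b c; apply/asboolP/andP => [ebc|[/asboolP eb /asboolP ec]]; last exact: eI.
split; apply/asboolP; apply: eS ebc _; apply: val_inj => /=.
  by rewrite (idemC (idem_mul_subproof b c) (idemP b)) mulgA idemP.
by rewrite -mulgA idemP.
Qed.

(** * Path elements and the tree of a character *)

Section Presented.
Local Open Scope group_scope.
Local Open Scope quotient_scope.
Variable E : sepgraph.
Implicit Types (v : vertex E) (e f : edge E) (X : set (edge E)).
Implicit Types (x y : letter E) (w : seq (letter E)) (p q : gpath E).
Implicit Types (Z W : set (gpath E)).

(** Both presentations satisfy this, so the two semigroups can be treated at once. *)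
Definition extends_relS (R : iterm (gens E) -> iterm (gens E) -> Prop) : Prop :=
  forall t u, pcong (relS E) t u -> pcong R t u.

Fixpoint nodes p w : set (gpath E) :=
  if w is x :: w' then [set p] `|` nodes (act p [:: x]) w' else [set p].

Lemma nodes_finite p w : finite_set (nodes p w).
Proof.
by elim: w p => [|x w IH] p /=; [|rewrite finite_setU; split=> //];
  exact: finite_set1.
Qed.

Section Relations.
Variable R : iterm (gens E) -> iterm (gens E) -> Prop.
Hypothesis RS : extends_relS R.
Local Notation S := (presented R).
Local Notation V v := (pgen R (inl v)).
Local Notation L x := (pgen R (inr x)).

Lemma pi_mul t u : \pi_S (IMul t u) = \pi_S t * \pi_S u.
Proof. by rewrite -pmulE. Qed.

Lemma pi_inv t : \pi_S (IInv t) = sinv (\pi_S t).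
Proof. by rewrite -pinvE. Qed.

Lemma pi_relS t u : relS E t u -> \pi_S t = \pi_S u.
Proof. by move=> tu; apply/presentedP/RS/pcong_rel. Qed.

Lemma V_mul v : V v * V v = V v.
Proof. by have := pi_relS (relS_vv v); rewrite pi_mul. Qed.

Lemma V_neq v v' : v <> v' -> V v * V v' = szero.
Proof. by move=> /relS_vw /pi_relS; rewrite pi_mul. Qed.

Lemma V_lsrc x : V (lsrc x) * L x = L x.
Proof. by have := pi_relS (relS_src x); rewrite pi_mul. Qed.

Lemma V_lrng x : L x * V (lrng x) = L x.
Proof. by have := pi_relS (relS_rng x); rewrite pi_mul. Qed.

Lemma L_neg_pos e : L (neg e) * L (pos e) = V (rng e).
Proof.
have [X sX Xe] := sep_ex e.
by have := pi_relS (relS_ee (sep_inC sX) Xe); rewrite pi_mul.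
Qed.

Lemma L_neg_pos0 X e f : inC X -> X e -> X f -> e <> f -> L (neg e) * L (pos f)
  = szero.
Proof. by move=> XC Xe Xf /(relS_ef XC Xe Xf) /pi_relS; rewrite pi_mul. Qed.

Lemma V_inv v : sinv (V v) = V v.
Proof. by apply: sinv_idem; exact: V_mul. Qed.

(** The relations e^-1 e = r(e), e r(e) = e and r(e) e^-1 = e^-1 make e^-1 an inverse of e, and
    inverses are unique. *)
Lemma L_inv x : sinv (L x) = L (linv x).
Proof.
have Lp e : L (neg e) = sinv (L (pos e)).
  apply: sinv_uniq; first by rewrite -mulgA L_neg_pos -[rng e]/(lrng (pos e))
    V_lrng.
  by rewrite L_neg_pos -[rng e]/(lsrc (neg e)) V_lsrc.
case: x => e [] /=; first by rewrite -Lp.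
by rewrite -[(e, false)]/(neg e) Lp sinvK.
Qed.

Definition lw (s : S) w : S := foldl (fun s x => s * L x) s w.

(** For [relLI] this unfolds to [path_elt p]. *)
Definition pelt p : S := lw (V p.1) p.2.

Definition pterm p : iterm (gens E) :=
  foldl (fun t x => IMul t (gx x)) (gv p.1) p.2.

Lemma pi_pterm p : \pi_S (pterm p) = pelt p.
Proof.
case: p => v w; elim/last_ind: w => // w x IH.
rewrite /pterm /pelt /lw /= -!cats1 !foldl_cat /= pi_mul -[X in X * _]/(\pi_S
  (pterm (v, w))).
by rewrite IH.
Qed.

Lemma lw_cat s w1 w2 : lw s (w1 ++ w2) = lw (lw s w1) w2.
Proof. exact: foldl_cat. Qed.

Lemma lw_rcons s w x : lw s (rcons w x) = lw s w * L x.
Proof. by rewrite -cats1 lw_cat. Qed.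

Lemma lw_mul s t w : lw (s * t) w = s * lw t w.
Proof. by elim: w t => //= x w IH t; rewrite -mulgA IH. Qed.

Lemma lw0 w : lw szero w = szero.
Proof. by elim: w => //= x w; rewrite smul0l. Qed.

Lemma pelt_V p : pelt p * V (prng p) = pelt p.
Proof.
case: p => v w; case/lastP: w => [|w x]; first exact: V_mul.
by rewrite /pelt lw_rcons prng_rcons -mulgA V_lrng.
Qed.

Lemma pelt_mul p q : prng p = q.1 -> pelt p * pelt q = pelt (p.1, p.2 ++ q.2).
Proof. by move=> pq; rewrite /pelt lw_cat -/(pelt p) -lw_mul -pq pelt_V. Qed.

Lemma pelt_mul0 p q : prng p <> q.1 -> pelt p * pelt q = szero.
Proof.
by move=> pq; rewrite -[pelt p]pelt_V -lw_mul -mulgA V_neq // smul0r lw0.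
Qed.

Lemma pelt_inv p : walk p.1 p.2 -> sinv (pelt p) = pelt (prng p, winv p.2).
Proof.
case: p => v w; elim/last_ind: w => [|w x IH]; first by rewrite /pelt /= V_inv.
move=> /walk_rcons[ww xE]; rewrite /pelt lw_rcons -/(pelt (v, w)) sinvM IH // L_inv.
rewrite -lw_mul winv_rcons prng_rcons /= -xE -lsrc_linv V_lsrc.
by rewrite -(lrng_linv x) V_lrng.
Qed.

(** Generators are path elements. A product of two is zero or the element of the concatenated path,
    and an inverse reverses the path. *)
Lemma pi_zero_or_pelt (t : iterm (gens E)) :
  \pi_S t = szero \/ exists2 p, walk p.1 p.2 & \pi_S t = pelt p.
Proof.
elim: t => [|[v|x]|t IHt u IHu|t IHt]; first by left.
- by right; exists (v, [::]).
- by right; exists (lsrc x, [:: x]) => //; rewrite /pelt /= V_lsrc.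
- rewrite pi_mul.
  case: IHt => [->|[p wp ->]]; first by left; rewrite smul0l.
  case: IHu => [->|[q wq ->]]; first by left; rewrite smul0r.
  have [pq|pq] := pselect (prng p = q.1); last by left; exact: pelt_mul0.
  right; exists (p.1, p.2 ++ q.2); last exact: pelt_mul.
  by rewrite walk_cat -/(prng p); split => //; case: (p) pq => ? ? /= ->.
rewrite pi_inv; case: IHt => [->|[p wp ->]].
  by left; rewrite sinv_idem // smul0l.
right; exists (prng p, winv p.2); last exact: pelt_inv.
by case: (p) wp => ? ? /= /walk_winv[].
Qed.

Variable phi : idem S -> bool.
Hypothesis phiP : spectrum phi.

(** Only reducedness is imposed here; that these paths are walks and separated comes out of
    [zset_tree]. *)
Definition zset : set (gpath E) := [set p | reduced p.2 && phi (sran (pelt p))].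

Lemma phi_lw s w : phi (sran (lw s w)) -> phi (sran s).
Proof. by elim/last_ind: w => // w x IH;
  rewrite lw_rcons => /phi_sranl - /(_ phiP). Qed.

(** The word [w] may backtrack. Truth at a path implies truth at its prefixes, which handles a
    letter extending [p]; a cancelling letter makes a detour, and [phi_sran_mid] splits off the
    condition at its tip. *)
Lemma phi_pelt p w : reduced p.2 -> walk p.1 (p.2 ++ w) ->
  phi (sran (pelt (p.1, p.2 ++ w))) <-> nodes p w `<=` zset.
Proof.
elim: w p => [|x w IH] p rp wp /=.
  rewrite cats0; have -> : (p.1, p.2) = p by case: p {rp wp}.
  by split=> [pp _ ->|/(_ p erefl) /andP[]//]; rewrite /zset /= rp.
have wx : walk (act p [:: x]).1 ((act p [:: x]).2 ++ w).
  rewrite /=; move: wp; rewrite -cat1s catA walk_cat => -[w1 w2]; rewrite walk_cat.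
  by have [? ->] := walk_red w1.
have := IH _ (act_reduced _ _) wx; rewrite subUset.
have -> : ([set p] `<=` zset) <-> phi (sran (pelt p)).
  by split=> [/(_ p erefl) /andP[]//|pp _ ->]; rewrite /zset /= rp.
move: wx; rewrite {1 2 3}/act /= cats1 => wx IHx.
case: (red_rconsP x rp) wx IHx => [w1 pE|rx] wx <-; last first.
  rewrite /= cat_rcons; split=> [pp|[]//]; split=> //.
  by rewrite /pelt lw_cat in pp; exact: phi_lw pp.
(* Here p = w1 x^-1, so p x w goes from w1 to p, back to w1, and on along [w]. *)
have -> : pelt (p.1, p.2 ++ x :: w) =
    pelt (p.1, w1) * (L (linv x) * sinv (L (linv x))) * pelt (lrng x, w).
  rewrite L_inv linvK pE cat_rcons /pelt /= lw_cat -lw_mul /=.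
  by rewrite -(mulgA _ (L _ * _)) -(mulgA (L _)) V_lrng mulgA.
have w1E : prng (p.1, w1) = lrng x.
  by move: wp; rewrite pE walk_cat => -[/walk_rcons[_ <-] _]; rewrite lsrc_linv.
rewrite phi_sran_mid // -lw_rcons -pE -[lw _ _]/(pelt p) pelt_mul //.
by split=> [/andP[]|[-> ->]].
Qed.

End Relations.
Lemma extends_relS_refl : extends_relS (relS E).
Proof. by []. Qed.

Lemma extends_relS_LI : extends_relS (relLI E).
Proof. exact: pcong_relLI. Qed.

Lemma term_normal (t : iterm (gens E)) : pcong (relS E) t IZero \/
  exists2 p, walk p.1 p.2 & pcong (relS E) t (pterm p).
Proof.
have [t0|[p wp tp]] := pi_zero_or_pelt extends_relS_refl t.
  by left; apply/presentedP.
by right; exists p => //; apply/presentedP; rewrite tp -pi_pterm.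
Qed.

(* [Q] does not depend on [R]: this is what makes characters of the two
   semigroups comparable. *)
Lemma char_support (t : iterm (gens E)) : exists (b : Prop) (Q : set (gpath E)),
  finite_set Q /\ forall R (phi : idem (presented R) -> bool), extends_relS R ->
    spectrum phi -> phi (sran (\pi_(presented R) t)) <-> b /\ Q `<=` zset phi.
Proof.
have [t0|[p wp tp]] := term_normal t.
  exists False, set0; split; first exact: finite_set0.
  move=> R phi RS phiP; have /presentedP -> := RS _ _ t0.
  by rewrite phi_sran0 //; split=> // -[].
exists True, (nodes (p.1, [::]) p.2); split; first exact: nodes_finite.
move=> R phi RS phiP; have /presentedP -> := RS _ _ tp.
rewrite pi_pterm -phi_pelt //=; case: (p) => u w /=.
by split=> [|[]].
Qed.

Implicit Types (R : iterm (gens E) -> iterm (gens E) -> Prop) (t : iterm (gens E)).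

Lemma char_le R R' (phi : idem (presented R) -> bool) (psi : idem (presented
  R') -> bool) t :
  extends_relS R -> extends_relS R' -> spectrum phi -> spectrum psi ->
  zset phi `<=` zset psi ->
  phi (sran (\pi_(presented R) t)) -> psi (sran (\pi_(presented R') t)).
Proof.
move=> RS RS' phiP psiP Zs; have [b [Q [_ H]]] := char_support t.
rewrite (H _ _ RS phiP) (H _ _ RS' psiP) => -[? QZ]; split=> //.
exact: subset_trans QZ Zs.
Qed.

Lemma char_eq R R' (phi : idem (presented R) -> bool) (psi : idem (presented
  R') -> bool) t :
  extends_relS R -> extends_relS R' -> spectrum phi -> spectrum psi ->
  zset phi = zset psi ->
  phi (sran (\pi_(presented R) t)) = psi (sran (\pi_(presented R') t)).
Proof.
by move=> RS RS' phiP psiP Ze; apply/idP/idP; apply: char_le; rewrite // Ze.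
Qed.

Lemma idem_term R (a : idem (presented R)) : exists t, a = sran (\pi_(presented
  R) t).
Proof. by exists (repr (val a)); rewrite reprK sran_idem. Qed.

Lemma char_inj R (phi psi : idem (presented R) -> bool) : extends_relS R ->
  spectrum phi -> spectrum psi -> zset phi = zset psi -> phi = psi.
Proof.
move=> RS phiP psiP Ze; apply/funext => a; have [t ->] := idem_term a.
exact: char_eq.
Qed.

(** Orthogonality of vertices forces a common source and matching endpoints; orthogonality of
    distinct edges of one class forces the edge condition. *)
Lemma zset_tree R (phi : idem (presented R) -> bool) : extends_relS R ->
  spectrum phi -> exists v, tree v (zset phi).
Proof.
move=> RS phiP; have [[a pa] _ _] := phiP.
have [t aE] := idem_term a; rewrite aE in pa.
have [t0|[p0 wp0 tp]] := pi_zero_or_pelt RS t.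
  by rewrite t0 phi_sran0 in pa.
rewrite tp in pa; have pv := phi_lw phiP pa;
  move: (p0.1) pv => v pv {a aE t p0 wp0 tp pa}.
have zE p : zset phi p -> phi (sran (pelt R p)) by case/andP.
have zw p : phi (sran (pelt R p)) -> p.1 = v /\ walk p.1 p.2.
  case: p => u w; elim/last_ind: w => [|w x IH] pp /=.
    split=> //; apply: contrapT => /(V_neq RS) uv.
    have := phi_mul phiP (sran (pelt R (u, [::]))) (sran (pgen R (inl v))).
    rewrite pp pv; have -> : idem_mul (sran (pelt R (u, [::]))) (sran (pgen R
      (inl v))) = sran szero.
      by apply: val_inj; rewrite /= /pelt /= !(V_inv RS) !(V_mul RS) uv smul0l.
    by rewrite phi_sran0.
  have [/= uv wu] : u = v /\ walk u w.
    by apply: IH; move: pp; rewrite /pelt lw_rcons => /(phi_sranl phiP).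
  split=> //; apply/walk_rcons; split => //; apply: contrapT => xu.
  move: pp; rewrite /pelt lw_rcons -[lw _ _]/(pelt R (u, w)) -(V_lsrc RS)
    -(pelt_V RS) -mulgA.
  by rewrite (mulgA (pgen _ _)) V_neq // ?smul0l ?smul0r ?phi_sran0 // => /esym.
exists v; split.
- by rewrite /zset /=.
- by move=> p /andP[rp /zw[-> wp]]; split.
- move=> u w x /andP[rx]; rewrite /pelt lw_rcons => /(phi_sranl phiP) pw.
  by rewrite /zset /= pw andbT; rewrite -cats1 in rx; exact: reduced_catl rx.
move=> p X e f Zp XC Xe Xf Ze Zf; apply: contrapT => ef.
have [rp pp] := andP Zp; have [pv' wp] := zw _ pp.
have pe : prng p = src e.
  have [/andP[_ /zw[_]]] := (conj Ze I); rewrite /act /= cats1.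
  case: red_rconsP => // [w pE _|_ /walk_rcons[_ eE]]; last first.
    by rewrite -[src e]/(lsrc (pos e)) eE; case: (p).
  by case: (p) pE => u w' /= ->; rewrite prng_rcons.
have ff : src f = src e by case: XC => u sX;
  rewrite (sep_src sX Xe) (sep_src sX Xf).
have wX : walk p.1 (p.2 ++ [:: pos e; neg e; pos f]).
  by rewrite walk_cat; split=> //=;
    rewrite -[src e]/(lsrc (pos e)) /lsrc /lrng /= ff -pe; case: (p).
(* The walk p e e^-1 f visits only p, p e and p f, so [phi] holds on it; yet its element is zero
   because e^-1 f = 0. *)
have : phi (sran (pelt R (p.1, p.2 ++ [:: pos e; neg e; pos f]))).
  apply/(phi_pelt RS phiP rp wX) => q /=.
  have -> : act (act p [:: pos e]) [:: neg e] = p by exact: act_linv.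
  by move=> [->|[->|[->|->]]].
by rewrite /pelt lw_cat /= -mulgA (L_neg_pos0 RS XC Xe Xf ef) smul0r phi_sran0.
Qed.

(** * The partial action of terms on complete trees *)

Definition state W : Prop := exists2 v, tree v W & complete finite_set W.

Lemma trans_state x W : state W -> W (lsrc x, [:: x]) -> state (trans x W).
Proof.
move=> [v tW cW] Wx; have /= vx := tree_root tW Wx; rewrite -vx in tW.
by exists (lrng x); [exact: trans_tree|exact: trans_complete].
Qed.

(* Terms act on complete sets by partial bijections. *)
Fixpoint ev (t : iterm (gens E)) W W' : Prop :=
  match t with
  | IZero => False
  | IGen (inl v) => [/\ state W, W (v, [::]) & W' = W]
  | IGen (inr x) => [/\ state W, W (lsrc x, [:: x]) & W' = trans x W]
  | IMul t u => exists2 W1, ev t W W1 & ev u W1 W'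
  | IInv t => ev t W' W
  end.

Lemma state_tree W p : state W -> W p -> tree p.1 W.
Proof. by move=> [v tW _] /(tree_root tW) ->. Qed.

Lemma ev_state t W W' : ev t W W' -> state W /\ state W'.
Proof.
elim: t W W' => [|[v|x]|t IHt u IHu|t IHt] W W' //=.
- by move=> [sW _ ->].
- by move=> [sW Wx ->]; split=> //; exact: trans_state.
- by move=> [W1 /IHt[? _] /IHu[_ ?]].
by move=> /IHt[].
Qed.

Lemma ev_inj t : (forall W W1 W2, ev t W W1 -> ev t W W2 -> W1 = W2) /\
  (forall W W1 W2, ev t W1 W -> ev t W2 W -> W1 = W2).
Proof.
elim: t => [|[v|x]|t [IHt1 IHt2] u [IHu1 IHu2]|t [IHt1 IHt2]] //=.
- by split=> W W1 W2 [_ _ ->] [_ _ ->].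
- split=> W W1 W2 [s1 Wx1 e1] [s2 Wx2 e2]; first by rewrite e1 e2.
  rewrite -(trans_linv (state_tree s1 Wx1)) -(trans_linv (state_tree s2 Wx2)).
  by rewrite -e1 -e2.
split=> W W1 W2 [W3 t3 u3] [W4 t4 u4].
  by rewrite (IHt1 _ _ _ t3 t4) in u3; exact: IHu1 u3 u4.
by rewrite (IHu2 _ _ _ u3 u4) in t3; exact: IHt2 t3 t4.
Qed.

Definition respected R : Prop := forall t u, R t u ->
  forall W W', ev t W W' <-> ev u W W'.

(** Partial bijections form an inverse semigroup whose zero is the empty map, so only the relations
    in [R] remain to be respected. Idempotents t t^-1 commute because they act as partial
    identities. *)
Lemma ev_pcong R t u : respected R -> pcong R t u ->
  forall W W', ev t W W' <-> ev u W W'.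
Proof.
move=> RC; elim=> {t u} //=.
- by move=> t u _ IH W W'; rewrite IH.
- by move=> t u w _ IH1 _ IH2 W W'; rewrite IH1.
- move=> t t' u u' _ IHt _ IHu W W'.
  by split=> -[W1 /IHt t1 /IHu u1]; exists W1.
- move=> t u w W W'; split=> [[W1 t1 [W2 u2 w2]]|[W2 [W1 t1 u2] w2]].
    by exists W2 => //; exists W1.
  by exists W1 => //; exists W2.
- by move=> t u W W'; split=> -[W1 ? ?]; exists W1.
- move=> t W W'; split=> [[W2 [W1 t1 t2] t3]|t1].
    by rewrite -((ev_inj t).2 _ _ _ t1 t2) in t3.
  by exists W => //; exists W'.
- have H t u W W' : ev (IMul (IMul t (IInv t)) (IMul u (IInv u))) W W' ->
      ev (IMul (IMul u (IInv u)) (IMul t (IInv t))) W W'.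
    move=> [W2 [W1 t1 t2] [W3 u3 u4]].
    rewrite /= -((ev_inj t).2 _ _ _ t1 t2) in u3.
    rewrite -((ev_inj u).2 _ _ _ u3 u4).
    by exists W; [exists W3|exists W1].
  by move=> t u W W'; split; exact: H.
- by move=> t W W'; split=> // -[].
- by move=> t W W'; split=> // -[].
Qed.

Lemma state_root W p : state W -> W p -> W (p.1, [::]).
Proof. by move=> sW Wp; have [] := state_tree sW Wp. Qed.

Lemma trans_back x W : state W -> W (lsrc x, [:: x]) ->
  trans x W (lsrc (linv x), [:: linv x]).
Proof.
move=> sW Wx; split; rewrite ?lsrc_linv //= eqxx.
exact: (state_root sW Wx).
Qed.

Lemma ev_trans_linv x W W' :
  ev (IMul (gx x) (gx (linv x))) W W' <-> [/\ state W, W (lsrc x, [:: x]) & W' = W].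
Proof.
have tK sW Wx := trans_linv (@state_tree W (lsrc x, [:: x]) sW Wx).
split=> /= [[_ [sW Wx ->] [_ _ ->]]|[sW Wx ->]]; first by rewrite tK.
exists (trans x W) => //; split; [exact: trans_state|exact: trans_back|].
by rewrite tK.
Qed.

(** For e^-1 e = r(e), a complete tree contains every inverse edge at its root. For e^-1 f = 0, the
    node e^-1 would have neighbours along both e and f. *)
Lemma respected_relS : respected (relS E).
Proof.
move=> t u; case=> {t u}.
- move=> v W W'; split=> /= [[_ [sW Wv ->] [_ _ ->]]|[sW Wv ->]] //.
  by exists W.
- move=> v w vw W W'; split=> //= -[_ [[u tW _] Wv ->] [_ Ww _]]; apply: vw.
  by rewrite -[v]/(v, [::] : seq (letter E)).1 (tree_root tW Wv) -(tree_root tW Ww).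
- move=> x W W'; split=> /= [[_ [sW Wv ->] [_ Wx ->]]|[sW Wx ->]] //.
  by exists W => //; split=> //; exact: (state_root sW Wx).
- move=> x W W'; split=> /= [[_ [sW Wx ->] [_ _ ->]]|[sW Wx ->]] //.
  by exists (trans x W) => //; split=> //; exact: trans_state.
- move=> X e XC Xe W W'; rewrite -[pos e]/(linv (neg e)) ev_trans_linv /=.
  split=> -[sW Wx ->]; split=> //; first exact: (state_root sW Wx).
  have [v tW cW] := sW; have [/(_ e) ce _] := cW _ Wx.
  by have := ce erefl; rewrite /act.
move=> X e f XC Xe Xf ef W W'; split=> //= -[_ [sW Wx ->] [_ [_ _ Wf] _]].
have [_ _ _ Ws] := state_tree sW Wx; apply: ef.
apply: (Ws (rng e, [:: neg e]) X e f) => //.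
by rewrite /act /= eqxx; exact: (state_root sW Wx).
Qed.

Lemma respected_relLI : respected (relLI E).
Proof.
move=> t u; case=> {t u} [t u|e eC W W']; first exact: respected_relS.
rewrite -[neg e]/(linv (pos e)) ev_trans_linv /=.
split=> -[sW Wx ->]; split=> //; first exact: (state_root sW Wx).
have [v tW cW] := sW; have [_ ce] := cW _ Wx.
have [//|_ -> ] := ce [set e] _ (finite_set1 e); first exact: inC_sep.
by rewrite /act.
Qed.

(** Letter by letter, [p] acts as the translation from [W] to p^-1 W. It is defined when all
    prefixes of [p] lie in [W], that is, when [p] does. *)
Lemma ev_pterm p W W' : reduced p.2 -> ev (pterm p) W W' <->
  [/\ state W, W p & W' = [set q | [/\ q.1 = prng p, reduced q.2
                                   & W (p.1, red (p.2 ++ q.2))]]].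
Proof.
case: p => v w /=; elim/last_ind: w W' => [|w x IH] W' rw.
  split=> -[sW Wv W'E]; split=> //; have tW := state_tree sW Wv; rewrite W'E.
    apply/seteqP; split=> [q Wq|q [qv rq]] /=.
      have [qv rq] := (tree_root tW Wq, tree_reduced tW Wq).
      by split=> //; rewrite red_id //; case: (q) qv Wq => ? ? /= ->.
    by rewrite red_id // => Wq; case: q qv Wq {rq} => ? ? /= ->.
  apply/seteqP; split=> [q [qv rq]|q Wq] /=.
    by rewrite red_id // => Wq; case: q qv Wq {rq} => ? ? /= ->.
  have [qv rq] := (tree_root tW Wq, tree_reduced tW Wq).
  by split=> //; rewrite red_id //; case: (q) qv Wq => ? ? /= ->.
have rw' : reduced w by rewrite -cats1 in rw; exact: reduced_catl rw.
pose W1 := [set q | [/\ q.1 = prng (v, w), reduced q.2 & W (v, red (w ++ q.2))]].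
have W1E : trans x W1 = [set q | [/\ q.1 = prng (v, rcons w x), reduced q.2
    & lsrc x = prng (v, w) /\ W (v, red (rcons w x ++ q.2))]].
  have e q : red (w ++ red (x :: q.2)) = red (rcons w x ++ q.2).
    by rewrite red_catr cat_rcons.
  apply/seteqP; split=> q; rewrite /trans /W1 prng_rcons /mkset -e.
    by move=> [q1 rq [xE _ Wq]].
  by move=> [q1 rq [xE Wq]]; split=> //; split=> //; exact: red_reduced.
have xP : W (v, rcons w x) -> state W -> lsrc x = prng (v, w).
  by move=> Wx sW; have /walk_rcons[] := tree_walk (state_tree sW Wx) Wx.
rewrite /pterm /= -cats1 foldl_cat /= -[foldl _ _ _]/(pterm (v, w)) cats1.
split=> [[W2 /IH - /(_ rw') [sW Ww ->] [_ [_ _ Wx] ->]]|[sW Wx ->]].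
  rewrite [(_, _).2]/= cats1 red_id // in Wx; split=> //; rewrite -/W1 W1E.
  by apply/seteqP; split=> q [? ? ?]; split=> //; [tauto|split=> //; exact: xP].
have Ww : W (v, w) := tree_lowerset (state_tree sW Wx) Wx.
have e1 : ev (pterm (v, w)) W W1 by apply/IH.
exists W1 => //; have [_ s1] := ev_state e1; split=> //.
  by split=> //=; [exact: xP|rewrite cats1 red_id].
rewrite W1E; apply/seteqP; split=> q [? ? ?]; split=> //; [split=> //;
  exact: xP|tauto].
Qed.

(** * The character of a complete tree *)

Section CompleteCharacter.
Variable R : iterm (gens E) -> iterm (gens E) -> Prop.
Hypotheses (RS : extends_relS R) (RC : respected R).

(** Idempotents act as partial identities, by [ev_idem]; the character tests whether [W] is in their
    domain. *)
Definition cchar W : idem (presented R) -> bool :=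
  fun a => `[< exists W', ev (repr (val a)) W W' >].

Lemma ev_repr t W W' : ev (repr (\pi_(presented R) t)) W W' <-> ev t W W'.
Proof. exact/(ev_pcong RC)/pcong_repr. Qed.

Lemma ev_idem (a : idem (presented R)) W W' : ev (repr (val a)) W W' -> W' = W.
Proof.
have [t aE] : exists t, val a = \pi_(presented R) t by exists (repr (val a));
  rewrite reprK.
have := idemP a; rewrite aE -pi_mul => /presentedP /(ev_pcong RC) aa.
rewrite ev_repr => t1; have [W1 t2 t3] := (aa _ _).2 t1.
have W1E := (ev_inj t).1 _ _ _ t1 t2; rewrite -W1E in t3.
exact: (ev_inj t).2 _ _ _ t3 t1.
Qed.

Lemma cchar_spectrum W : state W -> spectrum (cchar W).
Proof.
move=> sW; have [v tW _] := sW; split.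
- exists (sran (pgen R (inl v))); apply/asboolP; exists W.
  rewrite /= (V_inv RS) (V_mul RS); apply/ev_repr; split=> //.
  by case: tW.
- by apply/asboolP => -[W']; rewrite ev_repr.
move=> a b; have abE W1 W2 : ev (repr (val (idem_mul a b))) W1 W2 <->
    ev (IMul (repr (val a)) (repr (val b))) W1 W2.
  have -> : val (idem_mul a b) =
      \pi_(presented R) (IMul (repr (val a)) (repr (val b))).
    by rewrite pi_mul !reprK.
  exact: ev_repr.
apply/asboolP/andP => [[W' /abE[W1 aW1 bW1]]|[/asboolP[W1 a1] /asboolP[W2 b2]]].
  by split; apply/asboolP; [exists W1|exists W'; rewrite (ev_idem aW1) in bW1].
by exists W2; apply/abE; exists W => //; rewrite -{2}(ev_idem a1).
Qed.

Lemma cchar_zset W : state W -> zset (cchar W) = W.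
Proof.
move=> sW; apply/seteqP; split=> p.
  move=> /andP[rp /asboolP[W' /=]]; rewrite -pi_pterm -pi_inv -pi_mul ev_repr /=.
  by move=> [W1 /ev_pterm - /(_ rp)[]].
move=> Wp; have rp := tree_reduced (state_tree sW Wp) Wp; rewrite /zset /= rp.
apply/asboolP; rewrite /= -pi_pterm -pi_inv -pi_mul.
have := (ev_pterm W _ rp).2 (And3 sW Wp erefl); set W1 := (X in ev _ _ X) => e1.
by exists W; apply/ev_repr; exists W1.
Qed.

End CompleteCharacter.

(** A path of [Z] is followed inside [M]. Inverse edges are never missing; where [Z] takes an edge e
    of a class, [M] has some f of this class, and the edge condition in [Z] gives e = f. *)
Lemma full_maximal v M Z : tree v M -> complete setT M -> tree v Z ->
  M `<=` Z -> Z = M.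
Proof.
move=> tM cM tZ MZ; apply/seteqP; split=> // -[u w].
elim/last_ind: w => [|w x IH] Zw.
  by have /= -> := tree_root tZ Zw; case: tM.
have Zw' := tree_lowerset tZ Zw; have Mw := IH Zw'; have [cn cX] := cM _ Mw.
have rx := tree_reduced tZ Zw; have /walk_rcons[_ xE] := tree_walk tZ Zw.
rewrite -act_rcons //; case: x => e [] /= in Zw rx xE *; last exact: cn.
have [X sX Xe] := sep_ex e.
have sX' : sep (prng (u, w)) X by rewrite -xE.
have [f Xf Mf] := cX _ sX' I; have [_ _ _ Zs] := tZ.
suff -> : e = f by [].
apply: (Zs (u, w) X) => //; [exact: sep_inC sX|by rewrite act_rcons|exact: MZ].
Qed.

Lemma complete_weaken W : complete setT W -> complete finite_set W.
Proof. by move=> cW p /cW[cn cX]; split=> // X sX _; exact: cX. Qed.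

(** * Ultrafilters as full trees, tight characters as complete trees *)

Section Tight.
Variable R : iterm (gens E) -> iterm (gens E) -> Prop.
Hypotheses (RS : extends_relS R) (RC : respected R).
Implicit Types phi : idem (presented R) -> bool.

(** With no path to avoid, the tree of [phi] extends to a full tree. The character of the latter
    lies above [phi], so it equals [phi] by maximality of the ultrafilter. *)
Lemma ultra_full phi : ultra_spectrum phi ->
  exists2 v, tree v (zset phi) & complete setT (zset phi).
Proof.
move=> [phiP [_ phiM]]; have [v tZ] := zset_tree RS phiP.
have [//|||M [tM ZM _ cM]] := @complete_extension E v (zset phi) set0 tZ.
- exact: finite_set0.
- by [].
have sM : state M by exists v => //; exact: complete_weaken.
have cP := cchar_spectrum RS RC sM; have cZ := cchar_zset RC sM.
have phiE : phi = @cchar R M.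
  have le a : phi a -> cchar M a.
    by have [t ->] := idem_term a; apply: char_le => //; rewrite cZ.
  have eM := phiM _ (spectrum_filter cP) le.
  apply/funext => a; apply/idP/idP; first exact: le.
  by move=> ca; have : [set a | cchar M a] a by []; rewrite eM.
by exists v; rewrite phiE cZ.
Qed.

(** The tree of a larger filter contains [M], hence equals [M], and a character is determined by its
    tree. *)
Lemma full_ultra v M : tree v M -> complete setT M -> ultra_spectrum (@cchar R M).
Proof.
move=> tM cM; have sM : state M by exists v => //; exact: complete_weaken.
have cP := cchar_spectrum RS RC sM; have cZ := cchar_zset RC sM.
split=> //; split; first exact: spectrum_filter cP.
move=> eta etaF cE; have psiP := filter_spectrum etaF.
set psi := (fun a => _) in psiP.
have MZ : M `<=` zset psi.
  rewrite -{1}cZ => p /andP[rp pp]; rewrite /zset /= rp; apply/asboolP; exact: cE.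
have [v' tZ] := zset_tree RS psiP.
have vv : v = v' by have [M0 _ _ _] := tM; have := tree_root tZ (MZ _ M0).
rewrite -vv in tZ.
have psiE : psi = cchar M.
  by apply: (char_inj RS) => //; rewrite cZ; exact: full_maximal tM cM tZ MZ.
by rewrite -psiE; apply/funext => a; rewrite /psi; apply/propext; split=> /asboolP.
Qed.

(** Each requirement of completeness at a node concerns one inverse edge or one finite class, hence
    finitely many paths. The character of an ultrafilter that agrees with [phi] on these paths meets
    it. *)
Lemma tight_state phi : tight_set phi -> state (zset phi).
Proof.
move=> [phiP /closure_agreeP phiC]; have [v tZ] := zset_tree RS phiP.
exists v => // p Zp.
have zE (psi : idem (presented R) -> bool) (Q : set (gpath E)) :
    agree [set sran (pelt R q) | q in Q] phi psi ->
    forall q, Q q -> zset psi q <-> zset phi q.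
  by move=> ag q Qq; rewrite /zset /= ag //; exists q.
have [rp pp] := andP Zp; split=> [e ep|X sX fX].
  pose Q := [set p; act p [:: neg e]].
  have fQ : finite_set Q by rewrite finite_setU; split; exact: finite_set1.
  have [psi psiU /zE ag] := phiC _ (finite_image (fun q => sran (pelt R q)) fQ).
  have [u tpsi cpsi] := ultra_full psiU.
  apply/ag; first by right.
  by have [+ _] := cpsi p ((ag p (or_introl erefl)).2 Zp); apply.
pose Q := [set p] `|` [set act p [:: pos e] | e in X].
have fQ : finite_set Q.
  by rewrite finite_setU; split; [exact: finite_set1|exact: finite_image].
have [psi psiU /zE ag] := phiC _ (finite_image (fun q => sran (pelt R q)) fQ).
have [u tpsi cpsi] := ultra_full psiU.
have [_ /(_ X sX I)[e Xe Ze]] := cpsi p ((ag p (or_introl erefl)).2 Zp).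
by exists e => //; apply/ag => //; right; exists e.
Qed.

Lemma idem_support (a : idem (presented R)) : exists (b : Prop) (Q : set (gpath E)),
  finite_set Q /\ forall phi, spectrum phi -> phi a <-> b /\ Q `<=` zset phi.
Proof.
have [t ->] := idem_term a; have [b [Q [fQ H]]] := char_support t.
by exists b, Q; split=> // phi phiP; exact: H.
Qed.

(** Finitely many idempotents test finitely many paths, whose prefixes form the finite set [D]. A
    full extension of [W] that meets [D] only inside [W] has the same values on these
    idempotents. *)
Lemma state_tight W : state W -> tight_set (@cchar R W).
Proof.
move=> sW; have [v tW cW] := sW; have cP := cchar_spectrum RS RC sW.
split=> //; apply/closure_agreeP => P fP.
have /choice[Q HQ] (a : idem (presented R)) : exists Q : set (gpath E),
    finite_set Q /\ exists b : Prop, forall phi, spectrum phi ->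
      phi a <-> b /\ Q `<=` zset phi.
  by have [b [Q [? ?]]] := idem_support a; exists Q; split=> //; exists b.
pose D := Defs.down (\bigcup_(a in P) Q a).
have fD : finite_set D.
  by apply/finite_down/bigcup_finite => // a _; case: (HQ a).
have [|M [tM WM MD cM]] := complete_extension tW (@lowerset_down _ _) fD.
  by move=> p Wp _; exact: cW.
have sM : state M by exists v => //; exact: complete_weaken.
exists (cchar M); first exact: full_ultra tM cM.
move=> a Pa; have [_ [b Hb]] := HQ a.
have cPM := cchar_spectrum RS RC sM.
apply/idP/idP => /Hb - /(_ _)[]; rewrite // ?cchar_zset // => hb QM.
  apply/Hb => //; split=> //; rewrite cchar_zset // => q Qq; apply: MD.
  by split; [exact: QM|apply: downW; exists a].
by apply/Hb => //; split=> //; rewrite cchar_zset //; exact: subset_trans WM.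
Qed.

End Tight.
End Presented.

Lemma homeomorphism_comp (X Y Z : topologicalType) (f : X -> Y) (g : Y -> Z) :
  homeomorphism f -> homeomorphism g -> homeomorphism (g \o f).
Proof.
move=> [cf [f' [fK f'K cf']]] [cg [g' [gK g'K cg']]]; split.
  by move=> x; apply: continuous_comp; [exact: cf|exact: cg].
exists (f' \o g'); split; [exact: can_comp|exact: can_comp|].
by move=> x; apply: continuous_comp; [exact: cg'|exact: cf'].
Qed.

(** * The tight spectra *)

Section Transfer.
Local Open Scope group_scope.
Local Open Scope quotient_scope.
Variable E : sepgraph.
Implicit Types R : iterm (gens E) -> iterm (gens E) -> Prop.

Lemma sconj_sran (S : invSemigroup0Type) (s x : S) :
  sconj s (sran x) = sran (sinv s * x).
Proof. by apply: val_inj; rewrite /= sinvM sinvK !mulgA. Qed.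

Lemma sdom_sran (S : invSemigroup0Type) (s : S) : sdom s = sran (sinv s).
Proof. by apply: val_inj; rewrite /= sinvK. Qed.

(** The term representing [s] is read in the other semigroup. It is nonzero there because [phi']
    holds at its domain idempotent, and so its degree is that of the term. *)
Lemma transfer_elt R R' (phi : idem (presented R) -> bool)
    (phi' : idem (presented R') -> bool) (s : presented R) :
  extends_relS R -> extends_relS R' -> graded R' -> spectrum phi -> spectrum phi' ->
  zset phi = zset phi' -> phi (sdom s) ->
  let s' := \pi_(presented R') (repr s) in
  [/\ s' <> szero, deg s' = deg s & phi' (sdom s')].
Proof.
move=> RS RS' gR' phiP phiP' Ze ps s'.
have ps' : phi' (sdom s').
  move: ps; rewrite !sdom_sran /s' -{1}[s]reprK -!pi_inv.
  by rewrite (char_eq _ RS RS' phiP phiP' Ze).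
have s0 : s' <> szero.
  by move=> s0; move: ps'; rewrite s0 sdom_sran sinv_idem ?smul0l // phi_sran0.
by split=> //; rewrite /s' degE.
Qed.

Lemma theta_transfer R R' (phi psi : idem (presented R) -> bool)
    (phi' psi' : idem (presented R') -> bool) (g : free E) :
  extends_relS R -> extends_relS R' -> graded R' ->
  spectrum phi -> spectrum psi -> spectrum phi' -> spectrum psi' ->
  zset phi = zset phi' -> zset psi = zset psi' ->
  theta g phi psi -> theta g phi' psi'.
Proof.
move=> RS RS' gR' phiP psiP phiP' psiP' Ze Ze' [s [s0 sg ps H]].
have [s'0 s'g ps'] := transfer_elt RS RS' gR' phiP phiP' Ze ps.
exists (\pi_(presented R') (repr s)); split; rewrite ?s'g // => a.
have [t ->] := idem_term a; rewrite sconj_sran -pi_inv -pi_mul.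
rewrite -(char_eq _ RS RS' psiP psiP' Ze') H.
by rewrite -(char_eq _ RS RS' phiP phiP' Ze) pi_mul pi_inv reprK sconj_sran.
Qed.

Lemma theta_dom_transfer R R' (phi : idem (presented R) -> bool)
    (phi' : idem (presented R') -> bool) (g : free E) :
  extends_relS R -> extends_relS R' -> graded R' -> spectrum phi -> spectrum phi' ->
  zset phi = zset phi' -> theta_dom g phi -> theta_dom g phi'.
Proof.
move=> RS RS' gR' phiP phiP' Ze [s [s0 sg ps]].
have [s'0 s'g ps'] := transfer_elt RS RS' gR' phiP phiP' Ze ps.
by exists (\pi_(presented R') (repr s)); split; rewrite ?s'g.
Qed.

(** Whether a character is in the domain of theta_g, and which character it is sent to, depends only
    on the trees of the characters. *)
Lemma equivariant_zset R R'
    (h : tight_spectrum (presented R) -> tight_spectrum (presented R')) :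
  extends_relS R -> extends_relS R' -> graded R -> graded R' ->
  (forall phi, zset (set_val (h phi)) = zset (set_val phi)) -> equivariant h.
Proof.
move=> RS RS' gR gR' hZ g phi.
have sP R0 (x : tight_spectrum (presented R0)) : spectrum (set_val x).
  by have [] := set_valP x.
split; [split|move=> psi; split].
- exact: (theta_dom_transfer RS RS').
- exact: (theta_dom_transfer RS' RS).
- exact: (theta_transfer RS RS').
- exact: (theta_transfer RS' RS).
Qed.

End Transfer.

(** * The space of complete trees and its homeomorphisms *)

Section Model.
Variable E : sepgraph.
Implicit Types (p q : gpath E) (T F : set (gpath E)) (Z : TL E).

(* Both tight spectra and the Leavitt model are compared with the space of
   complete sets, a subspace of the product space of all sets of paths. *)
Definition model_set : set {ptws gpath E -> bool} := [set m | state [set p | m p]].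

Definition model : topologicalType := set_type model_set.

Definition mset (m : model) : set (gpath E) := [set p | set_val m p].

Lemma mset_state (m : model) : state (mset m).
Proof. exact: (set_valP m). Qed.

Lemma mset_inj : injective mset.
Proof.
move=> m m' e; apply: val_inj; apply/funext => p.
apply/idP/idP => mp; first by have : mset m' p by rewrite -e.
by have : mset m p by rewrite e.
Qed.

Section Spectra.
Variable R : iterm (gens E) -> iterm (gens E) -> Prop.
Hypotheses (RS : extends_relS R) (RC : respected R).

Lemma to_model_subproof (phi : tight_spectrum (presented R)) :
  (fun p => reduced p.2 && set_val phi (sran (pelt R p))) \in model_set.
Proof. by apply/mem_set; exact: (tight_state RS RC (set_valP phi)). Qed.

Definition to_model (phi : tight_spectrum (presented R)) : model :=
  SigSub (to_model_subproof phi).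

Lemma of_model_subproof (m : model) :
  (cchar (R := R) (mset m)) \in tight_set (S := presented R).
Proof. by apply/mem_set; exact: (state_tight RS RC (mset_state m)). Qed.

Definition of_model (m : model) : tight_spectrum (presented R) :=
  SigSub (of_model_subproof m).

Lemma to_model_mset phi : mset (to_model phi) = zset (set_val phi).
Proof. by []. Qed.

Lemma of_model_zset m : zset (set_val (of_model m)) = mset m.
Proof. exact: (cchar_zset RC (mset_state m)). Qed.

Lemma of_modelK : cancel of_model to_model.
Proof. by move=> m; apply: mset_inj; rewrite to_model_mset of_model_zset. Qed.

Lemma to_modelK : cancel to_model of_model.
Proof.
move=> phi; apply: val_inj; apply: (char_inj RS).
- by have [] := set_valP (of_model (to_model phi)).
- by have [] := set_valP phi.
exact: (of_model_zset (to_model phi)).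
Qed.

Lemma to_model_continuous : continuous to_model.
Proof.
apply: continuous_agree => p.
have HE phi psi : agree [set sran (pelt R p)] (set_val phi) (set_val psi) ->
    set_val (to_model phi) p = set_val (to_model psi) p.
  by move=> ag; congr andb; exact/esym/ag.
by split; apply: open_agree => phi pp; exists [set sran (pelt R p)];
  [exact: finite_set1|move=> psi /HE /= <-|exact: finite_set1|move=> psi /HE /= <-].
Qed.

(** The value at an idempotent depends only on the finitely many paths in its support [Q]. *)
Lemma of_model_continuous : continuous of_model.
Proof.
apply: continuous_agree => a; have [b [Q [fQ H]]] := idem_support RS a.
have HE m m' : agree Q (set_val m) (set_val m') ->
    set_val (of_model m) a = set_val (of_model m') a.
  move=> ag; have sub m0 : spectrum (set_val (of_model m0)).
    by have [] := set_valP (of_model m0).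
  have QE : Q `<=` mset m <-> Q `<=` mset m'.
    by split=> QS q Qq; have := QS _ Qq; rewrite /mset /= ag.
  by apply/idP/idP => /(H _ (sub _)); rewrite of_model_zset => -[hb hQ];
    apply/(H _ (sub _)); rewrite of_model_zset; split=> //; apply/QE.
by split; apply: open_agree => m ma; exists Q => // m' /HE /= <-.
Qed.

Lemma to_model_homeomorphism : homeomorphism to_model.
Proof.
by split; [exact: to_model_continuous|exists of_model; split;
  [exact: to_modelK|exact: of_modelK|exact: of_model_continuous]].
Qed.

Lemma of_model_homeomorphism : homeomorphism of_model.
Proof.
by split; [exact: of_model_continuous|exists to_model; split;
  [exact: of_modelK|exact: to_modelK|exact: to_model_continuous]].
Qed.

End Spectra.

(** * The topology of the Leavitt model *)

Lemma TL_valP (Z : TL E) : exists2 v, FL v (set_val Z) & NLfin (set_val Z) = set0.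
Proof. by have [[v FZ] nZ] := set_valP Z; exists v. Qed.

Lemma tl_of_model_subproof (m : model) : Lof (mset m) \in TL_set (E := E).
Proof.
have [v tW cW] := mset_state m; apply/mem_set; split; last exact: Lof_noexit tW cW.
by exists v; exact: FL_Lof.
Qed.

Definition tl_of_model (m : model) : TL E := SigSub (tl_of_model_subproof m).

Lemma model_of_tl_subproof (Z : TL E) :
  (fun p => `[< Wof (set_val Z) p >]) \in model_set.
Proof.
have [v FZ nZ] := TL_valP Z; apply/mem_set.
have -> : model_set (fun p => `[< Wof (set_val Z) p >]) = state (Wof (set_val Z)).
  by congr state; apply/seteqP; split=> p /asboolP.
by exists v; [exact: Wof_tree|exact: Wof_complete FZ nZ].
Qed.

Definition model_of_tl (Z : TL E) : model := SigSub (model_of_tl_subproof Z).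

Lemma mset_model_of_tl Z : mset (model_of_tl Z) = Wof (set_val Z).
Proof. by apply/seteqP; split=> p /asboolP. Qed.

Lemma tl_of_modelK : cancel tl_of_model model_of_tl.
Proof.
move=> m; apply: mset_inj; rewrite mset_model_of_tl.
by have [v tW cW] := mset_state m; exact: WofLof tW cW.
Qed.

Lemma model_of_tlK : cancel model_of_tl tl_of_model.
Proof.
move=> Z; apply: val_inj; have [v FZ _] := TL_valP Z.
by rewrite [LHS]/(Lof (mset (model_of_tl Z))) mset_model_of_tl; exact: LofWof FZ.
Qed.

(** [T] is generated by paths p with p_L = p, and [F] consists of such paths; they lie in the
    complete tree exactly when they lie in its model. *)
Lemma ZL_tl_of_model T F m : XL T -> F `<=` NLinf T ->
  ZL T F (set_val (tl_of_model m)) <-> T `<=` mset m /\ F `&` mset m = set0.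
Proof.
move=> [[u /FL_tree[tT eT]] _] FN; have [v tW cW] := mset_state m.
have lW := tree_lowerset tW.
split=> [[_ [TZ FZ]]|[TZ FZ]].
  split; first by move=> t /TZ /(Lof_sub lW).
  apply/seteqP; split=> // f [Ff mf]; rewrite -FZ; split=> //.
  apply: Lof_bigend => //; exact: NL_bigend (FN _ Ff).
split; first by exists v; exact: FL_Lof.
split=> [t /eT[t' [Tt' tt' bt']]|].
  by apply/(LofP _ lW); exists t'; split=> //; exact: TZ.
by apply/seteqP; split=> // f [Ff /(Lof_sub lW) mf]; rewrite -FZ.
Qed.

Lemma TL_base_ZL T F : XL T -> finite_set F -> F `<=` NLinf T ->
  TL_base E [set Z : TL E | ZL T F (set_val Z)].
Proof. by move=> XT fF FN; exists T, F. Qed.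

Lemma TL_base_filter (Z : TL E) :
  Filter (filter_from [set U | TL_base E U /\ U Z] id).
Proof.
have [v FZ nZ] := TL_valP Z; have [tZ _] := (FL_tree _ _).1 FZ.
have [Z0 _ _ _] := tZ; have b0 : bigend (v, [::] : seq (letter E)) by left.
apply: filter_from_filter.
  exists [set Z' : TL E | ZL (Defs.down [set (v, [::])]) set0 (set_val Z')].
  split; first by apply: TL_base_ZL => //; exact: XL_down tZ Z0 b0.
  split; first by exists v.
  split; last exact: set0I.
  by apply: lowerset_sub => [|_ ->//]; exact: tree_lowerset tZ.
move=> _ _ [[T1 [F1 [XT1 fF1 FN1 ->]]] Z1] [[T2 [F2 [XT2 fF2 FN2 ->]]] Z2].
have [T [F [XT fF FN ZT sub]]] := ZL_setI FZ XT1 XT2 fF1 fF2 FN1 FN2 Z1 Z2.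
exists [set Z' : TL E | ZL T F (set_val Z')]; last by move=> Z' /sub.
by split=> //; exact: TL_base_ZL.
Qed.

Lemma TL_base_open : TL_base E `<=` open.
Proof.
move=> U BU; exists [set U]; last by rewrite bigcup_set1.
move=> _ ->; exists [fset U]%fset; first by move=> V;
  rewrite in_fset1 => /eqP ->; apply/mem_set.
apply/seteqP; split=> [Z UZ|Z UZ V /=]; first by apply: UZ; rewrite /= inE.
by rewrite inE => /eqP ->.
Qed.

(** [TL_base] generates the topology as a subbase. By [ZL_setI] the basic sets containing [Z]
    generate a filter, which absorbs the finite intersections. *)
Lemma TL_base_cvg (Z : TL E) : filter_from [set U | TL_base E U /\ U Z] id --> Z.
Proof.
move=> B [_ [[D sD <-] [C DC CZ] DB]].
have FF := TL_base_filter Z.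
apply: (@filterS _ _ FF C); first by move=> Z' CZ'; apply: DB; exists C.
have /sD [D' sD' CE] := DC; rewrite -CE in CZ *.
apply: (@filter_bigI _ _ _ _ _ FF) => U UD; exists U => //.
by split; [have := sD' U UD; rewrite inE|exact: CZ].
Qed.

Lemma TL_base_basis : basis (TL_base E).
Proof. by split; [exact: TL_base_open|exact: TL_base_cvg]. Qed.

Lemma tl_of_model_continuous : continuous tl_of_model.
Proof.
move=> m B /TL_base_cvg[U [[T [F [XT fF FN ->]]] Um] UB].
apply: (@filterS _ _ _ [set m' | ZL T F (set_val (tl_of_model m'))]).
  by move=> m' Zm'; exact: UB.
apply: open_nbhs_nbhs; split=> //;
  apply: open_agree => m1 /(ZL_tl_of_model _ XT FN)[Tm Fm].
exists (T `|` F); first by rewrite finite_setU; split=> //; case: XT.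
move=> m2 ag; apply/(ZL_tl_of_model _ XT FN); split=> [t Tt|].
  by rewrite /mset /= ag; [exact: Tm|left].
apply/seteqP; split=> // f [Ff]; rewrite /mset /= ag; last by right.
by move=> mf; have : (F `&` mset m1) f by []; rewrite Fm.
Qed.

(** The coordinate at a separated [p] is membership of q = p_L in [Z]. Where it holds, requiring the
    prefixes of q is a basic open condition; where it fails, [TL_separate] gives a basic
    neighbourhood. A path that is not separated lies in no tree. *)
Lemma model_of_tl_continuous : continuous model_of_tl.
Proof.
apply: continuous_agree => p.
have valE (Z : TL E) : set_val (model_of_tl Z) p = `[< Wof (set_val Z) p >] by [].
have [Fp|nFp] := pselect (FCall p); last first.
  have nW (Z : TL E) : ~ Wof (set_val Z) p by case.
  split; [suff -> : [set Z | set_val (model_of_tl Z) p] = set0 by exact: open0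
         |suff -> : [set Z | ~~ set_val (model_of_tl Z) p] = setT by exact: openT].
    by apply/seteqP; split=> // Z; rewrite /= valE => /asboolP /nW.
  by apply/seteqP; split=> // Z _; rewrite /= valE; apply/asboolPn/nW.
have [q pq] := Lpart_ex p; have [w [pE nw bq]] := pq.
have Fq : FCall q.
  by case: q pE {pq bq} => u w' pE; apply: (@FC_prefix _ _ _ w); rewrite -pE.
have WE (Z : TL E) : Wof (set_val Z) p <-> set_val Z q.
  by have [v FZ _] := TL_valP Z; exact: Wof_Lpart FZ Fp pq.
split; rewrite openE => Z; rewrite /= valE /interior.
  move=> /asboolP/WE Zq.
  have [v FZ nZ] := TL_valP Z; have [tZ _] := (FL_tree _ _).1 FZ.
  apply: (@filterS _ _ _ [set Z' : TL E | ZL (Defs.down [set q]) set0 (set_val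
    Z')]).
    by move=> Z' [_ [dZ' _]]; rewrite /= valE; apply/asboolP/WE/dZ'; exact: downW.
  apply: open_nbhs_nbhs; split.
    by apply/TL_base_open/TL_base_ZL => //; exact: XL_down tZ Zq bq.
  split; first by exists v.
  split; last exact: set0I.
  by apply: lowerset_sub => [|_ ->//]; exact: tree_lowerset tZ.
move=> /asboolPn nZ; have [v FZ eZ] := TL_valP Z;
  have nq : ~ set_val Z q by move=> /WE.
have [T [F [XT fF FN ZT H]]] := TL_separate FZ eZ Fq bq nq.
apply: (@filterS _ _ _ [set Z' : TL E | ZL T F (set_val Z')]).
  by move=> Z' /H nZ'; rewrite /= valE; apply/asboolPn => /WE.
by apply: open_nbhs_nbhs; split=> //; exact/TL_base_open/TL_base_ZL.
Qed.

Lemma tl_of_model_homeomorphism : homeomorphism tl_of_model.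
Proof.
split; first exact: tl_of_model_continuous.
by exists model_of_tl; split; [exact: tl_of_modelK|exact: model_of_tlK|
  exact: model_of_tl_continuous].
Qed.

(** Each condition on [m] involves finitely many coordinates, because completeness concerns finite
    classes only. The root in [T] fixes the source of all approximating trees, so a limit is again a
    tree with this root. *)
Lemma closed_model T F v : T (v, [::]) ->
  closed [set m | model_set m /\ T `<=` [set p | m p] /\ F `&` [set p | m p] =
    set0].
Proof.
move=> T0; set C := (X in closed X) => m /closure_agreeP cm.
have H (P : set (gpath E)) : finite_set P -> exists W, [/\ tree v W, complete
  finite_set W,
    T `<=` W, F `&` W = set0 & forall p, P p -> m p <-> W p].
  move=> /cm[m' [[v' tW cW] [TW FW]] ag]; exists [set p | m' p].
  have vv := tree_root tW (TW _ T0); rewrite /= in vv; rewrite -vv in tW.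
  by split=> // p /ag <-.
have f1 p : finite_set [set p] by exact: finite_set1.
have f2 p q : finite_set [set p; q] by rewrite finite_setU.
have f3 p q r : finite_set [set p; q; r] by rewrite !finite_setU.
split; last split.
- exists v.
    split.
    + by have [W [_ _ TW _ WE]] := H _ (f1 (v, [::])); apply/WE => //; exact: TW.
    + move=> p mp; have [W [[_ WF _ _] _ _ _ WE]] := H _ (f1 p).
      by apply: WF; apply/WE.
    + move=> u w x mx; have [W [[_ _ Wr _] _ _ _ WE]] := H _ (f2 (u, rcons w x)
      (u, w)).
      by apply/WE; [right|apply: (Wr _ _ x); apply/WE; [left|]].
    move=> p X e f mp XC Xe Xf me mf.
    have [W [[_ _ _ Ws] _ _ _ WE]] := H _ (f3 p (act p [:: pos e]) (act p [::
      pos f])).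
    apply: (Ws p X) => //; apply/WE => //; first by left; left.
      by left; right.
    by right.
  move=> p mp; split=> [e ep|X sX fX].
    have [W [_ cW _ _ WE]] := H _ (f2 p (act p [:: neg e])).
    have [cn _] : complete_at finite_set W p by apply: cW; apply/WE => //; left.
    by apply/WE; [right|exact: cn].
  have [|W [_ cW _ _ WE]] := H ([set p] `|` [set act p [:: pos e] | e in X]).
    by rewrite finite_setU; split=> //; exact: finite_image.
  have [_ cX] : complete_at finite_set W p by apply: cW; apply/WE => //; left.
  by have [e Xe We] := cX _ sX fX; exists e => //; apply/WE => //; right; exists e.
- by move=> t Tt; have [W [_ _ TW _ WE]] := H _ (f1 t); apply/WE => //; exact: TW.
apply/seteqP; split=> // f [Ff mf]; have [W [_ _ _ FW WE]] := H _ (f1 f).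
by rewrite -FW; split=> //; apply/WE.
Qed.

(** Under [tl_of_model] a basic set is the image of a set of complete trees that is closed in the
    full power, hence compact. *)
Lemma TL_base_compact (U : set (TL E)) : TL_base E U -> compact U.
Proof.
move=> [T [F [XT fF FN ->]]].
have [v T0] : exists v, T (v, [::]).
  by have [[v /FL_tree[[T0 _ _ _] _]] _] := XT; exists v.
pose C := [set m : {ptws gpath E -> bool} |
  model_set m /\ T `<=` [set p | m p] /\ F `&` [set p | m p] = set0].
have CM : C `<=` model_set by move=> m [].
have cK := compact_agree CM (closed_model T0).
have -> : [set Z : TL E | ZL T F (set_val Z)] =
    tl_of_model @` [set m : model | C (set_val m)].
  apply/seteqP; split=> [Z ZZ|_ [m [_ [Tm Fm]] <-]];
    last exact/(ZL_tl_of_model _ XT FN).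
  exists (model_of_tl Z); last exact: model_of_tlK.
  split; first exact: set_valP.
  by apply/(ZL_tl_of_model (model_of_tl Z) XT FN); rewrite model_of_tlK.
apply: continuous_compact cK; apply: continuous_subspaceT.
exact: tl_of_model_continuous.
Qed.

End Model.

Theorem theorem7p7 (E : sepgraph) :
  exists (h : Omega E -> tightLI E) (k : tightLI E -> TL E),
    [/\ homeomorphism h,
        @equivariant E (relS E) (relLI E) h,
        homeomorphism k /\
          (forall phi : tightLI E, set_val (k phi) = L_model (set_val phi)),
        homeomorphism (fun phi : Omega E => k (h phi))
      & basis (TL_base E) /\
          (forall U : set (TL E), TL_base E U -> compact U /\ open U)].
Proof.
have RS := @extends_relS_refl E; have RC := @respected_relS E.
have RS' := @extends_relS_LI E; have RC' := @respected_relLI E.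
(* Both maps pass through the space of complete trees. *)
pose h (phi : Omega E) : tightLI E := of_model RS' RC' (to_model RS RC phi).
pose k (phi : tightLI E) : TL E := tl_of_model (to_model RS' RC' phi).
have hh : homeomorphism h.
  exact: (homeomorphism_comp (to_model_homeomorphism RS RC)
    (of_model_homeomorphism RS' RC')).
have hk : homeomorphism k.
  exact: (homeomorphism_comp (to_model_homeomorphism RS' RC')
    (@tl_of_model_homeomorphism E)).
exists h, k; split=> //.
- apply: equivariant_zset => //; [exact: relS_graded|exact: relLI_graded|].
  by move=> phi; rewrite of_model_zset.
- split=> // phi; have [phiP _] := set_valP phi; have [v tZ] := zset_tree RS' phiP.
  have -> : set_val (k phi) = Lof (zset (set_val phi)) by [].
  (* It remains to compare the generating paths g_L. The paths in the tree of [phi] are separated by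
     [tree_FC], and their elements are the [path_elt]. *)
  congr Defs.down; apply/seteqP; split=> q [g Zg gq]; exists g => //.
    split; last by case/andP: Zg.
    by have := tree_FC tZ Zg; rewrite /FCall /= (tree_root tZ Zg).
  by case: Zg => Fg pg; apply/andP; split=> //; exact: FC_reduced Fg.
- exact: homeomorphism_comp hh hk.
split; first exact: TL_base_basis.
by move=> U BU; split; [exact: TL_base_compact|exact: TL_base_open].
Qed.
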